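(* Let $M$ be a manifold on the Banach space $X=c_0(\gamma_X,\mathbf K)$ with a finite atlas and charts with $\phi_j(U_j)$ bounded in $X$ for each $j\in\Lambda_M$, where $char(\mathbf K)=p>1$. Then in $Diff^{\alpha}_b(M)$ in each neighborhood of $id$ there are $g\ne id$ which do not belong to any non-trivial one-parameter subgroup $g^y$ relative to the additive group $(\mathbf K,+)$. Moreover, if $M$ is embedded into $X$, $g\in Diff^\alpha_b(M)$, $h:=g-id$, $g\ne id$ and the functions $$(h-h\circ g^{-1}),\ (h-h\circ g^{-1})\circ g^2,\ \dots,\ (h-h\circ g^{-1})\circ g^{p-1}$$ are $\mathbf K$-linearly independent, then $g$ does not belong to any one-parameter subgroup $\{g^y: y\in(\mathbf K,+)\}$.
   Context: $\mathbf K$ is an infinite field with a nontrivial non-Archimedean multiplicative norm $|\cdot|$. Let $X,Y$ be topological vector spaces over $\mathbf K$, $U\subset X$ open, $f:U\to Y$. Put $U^{[1]}=\{(x,v,t)\in X^2\times\mathbf K: x\in U,\ x+tv\in U\}$ and $f^{[1]}(x,v,t)=(f(x+tv)-f(x))/t$ for $t\ne 0$; $f$ is of class $C^{[1]}$ if $f$ is continuous and $f^{[1]}$ extends continuously to $U^{[1]}$ (the extension is again denoted $f^{[1]}$). Inductively $U^{[n+1]}=(U^{[n]})^{[1]}$, $f^{[n+1]}=(f^{[n]})^{[1]}$, which defines the class $C^{[n]}$; write $\Upsilon^nf=f^{[n]}$. Put $\Phi^1f(x;v;t)=f^{[1]}(x,v,t)$ and $\Phi^{n+1}f(x;v_1,\dots,v_{n+1};t_1,\dots,t_{n+1})=\Phi^1(\Phi^nf(x;v_1,\dots,v_n;t_1,\dots,t_n))(x;v_{n+1};t_{n+1})$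 for all $t_i\ne0$ (difference quotient in $x$ only); $f$ is of class $C^n$ if $f$ is continuous and $\Phi^kf$ ($1\le k\le n$) has a continuous extension $\bar\Phi^kf$ to $U^{(k)}=\{(x;v_1,\dots,v_k;t_1,\dots,t_k): x\in U,\ x+v_1t_1\in U,\dots,x+v_1t_1+\dots+v_kt_k\in U\}$. $C^0=C^{[0]}$ means continuous; $C^\infty=\bigcap_nC^n$, $C^{[\infty]}=\bigcap_nC^{[n]}$. The index $\alpha$ is $n$ or $[n]$ with $0\le n\le\infty$; $S^k=\bar\Phi^k$ if $\alpha=n$, $S^k=\Upsilon^k$ if $\alpha=[n]$, $S^0f=f$. $C^\alpha_b(U,Y)$ is the subspace of those $f\in C^\alpha(U,Y)$ such that $f$ and all $S^kf$ ($k$ finite, $1\le k\le n$) are bounded and uniformly continuous on bounded open subsets of their domains. Its topology has a base of neighborhoods of zero consisting of the sets of $f$ such that $S^kf$ takes values in $V$ for $0\le k\le m$ at all arguments with $x\in P$, all vector increments in $P-y_0$ and all scalar arguments of norm $\le1$, where $m\le n$ is finite, $V$ is an open neighborhood of $0$ in $Y$, $P\subset U$ is bounded and open, $y_0\in P$. $c_0(\gamma,\mathbf K)$ is the space of families $(x_j)_{j\in\gamma}$ in $\mathbf K$ such that $\{j:|x_j|>\epsilon\}$ is finite for every $\epsilon>0$, with norm $\sup_j|x_j|$. The manifold $M$ has an atlas $(U_j,\phi_j)_{j\in\Lambda_M}$, $\bigcup_jU_j=M$, $U_j$ open, $\phi_j:U_j\to\phi_j(U_j)\subset X$ homeomorphisms,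 with transition maps of class $C^{\alpha'}_b$, $\alpha'\ge\alpha$. $Diff^\alpha_b(M)$ is the group of all homeomorphisms $f:M\to M$ such that all $\phi_j\circ f\circ\phi_i^{-1}$ are of class $C^\alpha_b$ on their domains, with the topology inherited through charts from $C^\alpha_b(X,X)$. A one-parameter subgroup relative to $(\mathbf K,+)$ is a family $\{g^y:y\in\mathbf K\}\subset Diff^\alpha_b(M)$ with $g^0=id$, $g^{y_1}g^{y_2}=g^{y_1+y_2}$, in which $g=g^1$. *)

(* Defs.v *)
From HB Require Import structures.
From mathcomp Require Import all_boot all_order all_algebra.
From mathcomp Require Import boolp classical_sets functions cardinality.
From mathcomp Require Import reals topology.

Set Implicit Arguments.
Unset Strict Implicit.
Unset Printing Implicit Defensive.
Import Order.TTheory GRing.Theory Num.Theory.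
Local Open Scope classical_set_scope.
Local Open Scope ring_scope.

(* Library norms (normedZmodType, normedModType) live over ordered fields
   (numDomainType), hence in characteristic 0; non-Archimedean norms with
   values in R are therefore introduced here.  A field carrying a nontrivial
   such norm is automatically infinite. *)
HB.mixin Record Field_isValued (R : realType) K & GRing.Field K := {
  absv : K -> R ;
  absv_ge0 : forall x, 0 <= absv x ;
  absv_eq0 : forall x, absv x = 0 -> x = 0 ;
  absvM : forall x y, absv (x * y) = absv x * absv y ;
  absvD : forall x y, absv (x + y) <= Num.max (absv x) (absv y) ;
  absv_nontrivial : exists x : K, x != 0 /\ absv x != 1
}.

#[short(type="valuedFieldType")]
HB.structure Definition ValuedField (R : realType) :=
  {K of GRing.Field K & Field_isValued R K}.

HB.mixin Record isUltraNormed (R : realType) (K : valuedFieldType R) V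
    & PseudoMetric R V & GRing.Lmodule K V := {
  unorm : V -> R ;
  unorm_ge0 : forall x, 0 <= unorm x ;
  unorm_eq0 : forall x, unorm x = 0 -> x = 0 ;
  unormZ : forall (a : K) x, unorm (a *: x) = absv a * unorm x ;
  unormD : forall x y, unorm (x + y) <= Num.max (unorm x) (unorm y) ;
  unorm_ball : forall (x y : V) (e : R), ball x e y = (unorm (x - y) < e)
}.

#[short(type="ultraNormedModType")]
HB.structure Definition UltraNormedModule (R : realType)
    (K : valuedFieldType R) :=
  {V of PseudoMetric R V & GRing.Lmodule K V & isUltraNormed R K V}.

Section absv_theory.
Context {R : realType} {K : valuedFieldType R}.
Implicit Types x y : K.

Lemma absv0 : absv (0 : K) = 0.
Proof.
have [x [_ x1]] := @absv_nontrivial R K.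
have /eqP := absvM (0 : K) x.
rewrite mul0r -{1}[absv 0]mulr1 -subr_eq0 -mulrBr mulf_eq0 subr_eq0.
by case/orP=> [/eqP //|/eqP/esym/eqP]; rewrite (negPf x1).
Qed.

Lemma absv1 : absv (1 : K) = 1.
Proof.
have /eqP := absvM (1 : K) 1.
rewrite mulr1 -{1}[absv 1]mulr1 -subr_eq0 -mulrBr mulf_eq0 subr_eq0.
case/orP=> [/eqP/absv_eq0/eqP|/eqP/esym //].
by rewrite oner_eq0.
Qed.

Lemma absvN x : absv (- x) = absv x.
Proof.
suff -> : absv (- x) = absv (-1 : K) * absv x.
  have /eqP : absv (-1 : K) ^+ 2 = 1 by rewrite expr2 -absvM mulrNN mulr1 absv1.
  rewrite sqrf_eq1 => /orP[/eqP ->|/eqP h]; first by rewrite mul1r.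
  by have := absv_ge0 (-1 : K); rewrite h oppr_ge0 ler10.
by rewrite -absvM mulN1r.
Qed.

End absv_theory.

(* The one-dimensional space K.  An alias is needed since the topology of the
   regular module K^o is reserved for ordered fields. *)
Definition line (R : realType) (K : valuedFieldType R) : Type := K.

Section line.
Context {R : realType} (K : valuedFieldType R).

HB.instance Definition _ := GRing.Lmodule.copy (line K) (K^o).

Let d (x y : line K) : R := absv (x - y : K).
Let dxx x : d x x = 0. Proof. by rewrite /d subrr absv0. Qed.
Let d_eq0 x y : d x y = 0 -> x = y.
Proof. by move/absv_eq0/eqP; rewrite subr_eq0 => /eqP. Qed.
Let dC x y : d x y = d y x. Proof. by rewrite /d -absvN opprB. Qed.
Let dD y x z : d x z <= d x y + d y z.
Proof.
rewrite /d; have -> : x - z = (x - y) + (y - z) by rewrite subrKA.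
rewrite (le_trans (absvD _ _))// ge_max.
by rewrite lerDl lerDr !absv_ge0.
Qed.

HB.instance Definition _ := isMetric.Build R (line K) dxx d_eq0 dC dD.

Let line_ge0 (x : line K) : 0 <= absv (x : K). Proof. exact: absv_ge0. Qed.
Let line_eq0 (x : line K) : absv (x : K) = 0 -> x = 0.
Proof. exact: absv_eq0. Qed.
Let lineZ (a : K) (x : line K) :
  absv ((a *: x : line K) : K) = absv a * absv (x : K).
Proof. exact: absvM. Qed.
Let lineD (x y : line K) :
  absv ((x + y : line K) : K) <= Num.max (absv (x : K)) (absv (y : K)).
Proof. exact: absvD. Qed.
Let line_ball (x y : line K) (e : R) :
  ball x e y = (absv ((x - y : line K) : K) < e).
Proof. by rewrite ballEmdist. Qed.

HB.instance Definition _ := isUltraNormed.Build R K (line K)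
  line_ge0 line_eq0 lineZ lineD line_ball.

End line.

(* Products carry the maximum norm, which induces the product topology. *)
Section prod_unorm.
Context {R : realType} {K : valuedFieldType R} (V W : ultraNormedModType K).

Let nrm (z : V * W) : R := Num.max (unorm z.1) (unorm z.2).
Let nrm_ge0 z : 0 <= nrm z. Proof. by rewrite le_max unorm_ge0. Qed.
Let nrm_eq0 z : nrm z = 0 -> z = 0.
Proof.
case: z => x y h.
have : nrm (x, y) <= 0 by rewrite h.
rewrite ge_max /= => /andP[x0 y0].
congr pair; apply: unorm_eq0; apply/eqP.
  by rewrite eq_le x0 unorm_ge0.
by rewrite eq_le y0 unorm_ge0.
Qed.
Let nrmZ (a : K) z : nrm (a *: z) = absv a * nrm z.
Proof. by rewrite /nrm /= !unormZ maxr_pMr// absv_ge0. Qed.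
Let nrmD z w : nrm (z + w) <= Num.max (nrm z) (nrm w).
Proof.
by rewrite /nrm ge_max; apply/andP; split;
  rewrite (le_trans (unormD _ _))// ge_max !le_max !lexx ?orbT.
Qed.
Let nrm_ball (z w : V * W) (e : R) : ball z e w = (nrm (z - w) < e).
Proof.
have -> : ball z e w = (ball z.1 e w.1 /\ ball z.2 e w.2) by [].
by rewrite !unorm_ball /nrm gt_max; apply/propext; split => [[-> ->]|/andP].
Qed.

HB.instance Definition _ := isUltraNormed.Build R K (V * W)%type
  nrm_ge0 nrm_eq0 nrmZ nrmD nrm_ball.

End prod_unorm.

Section c0.
Context {R : realType} (gamma : Type) (K : valuedFieldType R).

Definition null_family : {pred gamma -> K^o} := fun x =>
  `[< forall e : R, 0 < e -> finite_set [set j | e < absv (x j : K)] >].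

Lemma null_family_submod : submod_closed null_family.
Proof.
split.
  apply/asboolP => e e0; rewrite (_ : [set _ | _] = set0) //.
  by apply/seteqP; split => j //=; rewrite absv0 ltNge (ltW e0).
move=> a x y /asboolP hx /asboolP hy; apply/asboolP => e e0.
have e1 : 0 < e / (absv a + 1).
  by rewrite divr_gt0// ltr_wpDl// absv_ge0.
apply: (@sub_finite_set _ _ ([set j | e / (absv a + 1) < absv (x j : K)]
  `|` [set j | e < absv (y j : K)])); last first.
  by rewrite finite_setU; split; [exact: hx | exact: hy].
move=> j /= h; have := lt_le_trans h (absvD _ _).
rewrite lt_max => /orP[h'|h']; [left | by right].
have {}h' : e < absv a * absv (x j : K) by rewrite -absvM.
rewrite /= ltr_pdivrMr ?ltr_wpDl ?absv_ge0//.
by rewrite mulrDr mulr1 mulrC (lt_le_trans h')// lerDl absv_ge0.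
Qed.

HB.instance Definition _ :=
  GRing.isSubmodClosed.Build K (gamma -> K^o) null_family null_family_submod.

Record c0 := C0 { c0_val :> gamma -> K^o; _ : c0_val \in null_family }.

HB.instance Definition _ := [isSub for c0_val].
HB.instance Definition _ := [Choice of c0 by <:].
HB.instance Definition _ := [SubChoice_isSubLmodule of c0 by <:].

Definition c0_norm (x : c0) : R := sup (range (fun j => absv (x j : K))).

Lemma c0_has_sup (x : c0) (j0 : gamma) :
  has_sup (range (fun j => absv (x j : K))).
Proof.
split; first by exists (absv (x j0 : K)), j0.
have /asboolP /(_ 1 ltr01) := valP x.
move=> /(finite_image (fun j => absv (x j : K))) /finite_seqP [s sE].
exists (1 + \sum_(r <- s) `|r|) => _ [j _ <-].
have sum_ge0 (l : seq R) : 0 <= \sum_(r <- l) `|r| by apply: sumr_ge0.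
have [xj1|xj1] := leP (absv (x j : K)) 1; first by rewrite ler_wpDr.
have : absv (x j : K) \in s.
  have : [set` s] (absv (x j : K)) by rewrite -sE; exists j.
  by [].
move=> /perm_to_rem sp; rewrite (perm_big _ sp) big_cons /= addrCA.
by rewrite ler_wpDr ?ler_norm// addr_ge0.
Qed.

Lemma c0_norm_ub (x : c0) j : absv (x j : K) <= c0_norm x.
Proof. by apply: sup_upper_bound; [exact: c0_has_sup | exists j]. Qed.

Lemma c0_norm_le (x : c0) (b : R) :
  0 <= b -> (forall j, absv (x j : K) <= b) -> c0_norm x <= b.
Proof.
move=> b0 xb; rewrite /c0_norm.
have [j|g0] := pselect (exists j : gamma, True); last first.
  suff -> : range (fun j => absv (x j : K)) = set0 by rewrite sup0.
  by apply/seteqP; split => // r [j]; case: g0; exists j.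
case: j => j _; apply: ge_sup; first by exists (absv (x j : K)), j.
by move=> _ [i _ <-].
Qed.

Let c0_norm_ge0 x : 0 <= c0_norm x.
Proof.
have [[j _]|g0] := pselect (exists j : gamma, True).
  by rewrite (le_trans _ (c0_norm_ub x j))// absv_ge0.
suff -> : c0_norm x = 0 by [].
rewrite /c0_norm; suff -> : range (fun j => absv (x j : K)) = set0.
  by rewrite sup0.
by apply/seteqP; split => // r [j]; case: g0; exists j.
Qed.

Let c0_norm_eq0 x : c0_norm x = 0 -> x = 0.
Proof.
move=> x0; apply/val_inj/funext => j.
apply: (@absv_eq0 R K); apply/eqP.
by rewrite eq_le absv_ge0 andbT -x0; exact: c0_norm_ub.
Qed.

Let c0_normZ (a : K) (x : c0) : c0_norm (a *: x) = absv a * c0_norm x.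
Proof.
have le b (y : c0) : c0_norm (b *: y) <= absv b * c0_norm y.
  apply: c0_norm_le => [|j]; first by rewrite mulr_ge0// absv_ge0.
  rewrite [leLHS](absvM b (y j : K)) ler_wpM2l ?absv_ge0//.
  exact: c0_norm_ub.
apply/eqP; rewrite eq_le le /=.
have [->|a0] := eqVneq a 0; first by rewrite absv0 mul0r.
have aV : absv a^-1 * absv a = 1 by rewrite -absvM mulVf// absv1.
rewrite -[leRHS]mul1r -aV [absv a^-1 * _]mulrC -mulrA ler_wpM2l ?absv_ge0//.
by rewrite (le_trans _ (le _ _))// scalerA mulVf// scale1r.
Qed.

Let c0_normD x y : c0_norm (x + y) <= Num.max (c0_norm x) (c0_norm y).
Proof.
apply: c0_norm_le => [|j]; first by rewrite le_max c0_norm_ge0.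
rewrite (le_trans (absvD _ _))// ge_max !le_max !c0_norm_ub orbT.
by [].
Qed.

Let c0_norm0 : c0_norm 0 = 0.
Proof.
apply/eqP; rewrite eq_le c0_norm_ge0 andbT.
by apply: c0_norm_le => // j; rewrite absv0.
Qed.

Let c0_normN x : c0_norm (- x) = c0_norm x.
Proof. by rewrite -scaleN1r c0_normZ absvN absv1 mul1r. Qed.

Let d x y := c0_norm (x - y).
Let dxx x : d x x = 0. Proof. by rewrite /d subrr. Qed.
Let d_eq0 x y : d x y = 0 -> x = y.
Proof. by move/c0_norm_eq0/eqP; rewrite subr_eq0 => /eqP. Qed.
Let dC x y : d x y = d y x. Proof. by rewrite /d -c0_normN opprB. Qed.
Let dD y x z : d x z <= d x y + d y z.
Proof.
have -> : d x z = c0_norm ((x - y) + (y - z)) by rewrite subrKA.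
rewrite (le_trans (c0_normD _ _))// ge_max.
by rewrite lerDl lerDr !c0_norm_ge0.
Qed.

HB.instance Definition _ := isMetric.Build R c0 dxx d_eq0 dC dD.

Let c0_ball (x y : c0) (e : R) : ball x e y = (c0_norm (x - y) < e).
Proof. by rewrite ballEmdist. Qed.

HB.instance Definition _ := isUltraNormed.Build R K c0
  c0_norm_ge0 c0_norm_eq0 c0_normZ c0_normD c0_ball.

End c0.

Arguments c0 {R} gamma K.

Section banach.
Context {R : realType} {K : valuedFieldType R} (V : ultraNormedModType K).

Definition banach : Prop :=
  forall F : set_system V, ProperFilter F -> cauchy F -> exists l : V, F --> l.

Definition nbounded (A : set V) : Prop :=
  exists r : R, forall x, A x -> unorm x <= r.

End banach.

Section smoothness.
Context {R : realType} {K : valuedFieldType R}.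
Implicit Types X Y : ultraNormedModType K.
Unset Implicit Arguments.

(* Upsilon^k f is a function on X^[k], where X^[k+1] = X^[k] * X^[k] * K. *)
Fixpoint ups_space X (k : nat) : ultraNormedModType K :=
  if k is k'.+1 then (ups_space X k' * ups_space X k' * line K)%type else X.

(* U^[k] *)
Fixpoint ups_dom {X} (U : set X) (k : nat) : set (ups_space X k) :=
  match k return set (ups_space X k) with
  | 0 => U
  | k'.+1 => [set z : ups_space X k' * ups_space X k' * line K |
      ups_dom U k' z.1.1 /\ ups_dom U k' (z.1.1 + (z.2 : K) *: z.1.2)]
  end.

(* F is Upsilon^k f.  As {t <> 0} is dense in U^[k+1], the continuous
   extension is unique on U^[k+1]; values outside U^[k] are irrelevant. *)
Fixpoint is_ups {X Y} (U : set X) (f : X -> Y) (k : nat) :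
    (ups_space X k -> Y) -> Prop :=
  match k return (ups_space X k -> Y) -> Prop with
  | 0 => fun F => {within U, continuous F} /\ {in U, F =1 f}
  | k'.+1 => fun F : ups_space X k' * ups_space X k' * line K -> Y =>
      {within ups_dom U k'.+1, continuous F} /\
      exists2 G, is_ups U f k' G &
        forall x v (t : K), ups_dom U k'.+1 (x, v, t) -> t != 0 ->
          F (x, v, t) = t^-1 *: (G (x + t *: v) - G x)
  end.

(* Phi^k f has arguments (x; v_1,...,v_k; t_1,...,t_k), grouped here as
   ((x, v_1, t_1), ..., v_k, t_k). *)
Fixpoint phi_space X (k : nat) : ultraNormedModType K :=
  if k is k'.+1 then (phi_space X k' * X * line K)%type else X.

(* x + t_1 v_1 + ... + t_k v_k *)
Fixpoint phi_end {X} (k : nat) : phi_space X k -> X :=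
  match k return phi_space X k -> X with
  | 0 => id
  | k'.+1 => fun z : phi_space X k' * X * line K =>
      phi_end k' z.1.1 + (z.2 : K) *: z.1.2
  end.

(* U^(k) *)
Fixpoint phi_dom {X} (U : set X) (k : nat) : set (phi_space X k) :=
  match k return set (phi_space X k) with
  | 0 => U
  | k'.+1 => [set z : phi_space X k' * X * line K |
      phi_dom U k' z.1.1 /\ U (phi_end k'.+1 z)]
  end.

(* Replaces x by x + h, keeping the v_i and t_i. *)
Fixpoint phi_shift {X} (h : X) (k : nat) : phi_space X k -> phi_space X k :=
  match k return phi_space X k -> phi_space X k with
  | 0 => fun x => x + h
  | k'.+1 => fun z : phi_space X k' * X * line K =>
      (phi_shift h k' z.1.1, z.1.2, z.2)
  end.

Fixpoint Phi {X Y} (f : X -> Y) (k : nat) : phi_space X k -> Y :=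
  match k return phi_space X k -> Y with
  | 0 => f
  | k'.+1 => fun z : phi_space X k' * X * line K =>
      (z.2 : K)^-1 *:
        (Phi f k' (phi_shift ((z.2 : K) *: z.1.2) k' z.1.1) - Phi f k' z.1.1)
  end.

(* The points where the iterated difference quotient is defined: all t_i are
   nonzero and f is only evaluated in U.  These points lie in U^(k), but for
   k > 1 they need not be dense in {t_i <> 0}, since U^(k) does not contain,
   say, the condition that x + t_2 v_2 be in U. *)
Fixpoint Phi_def {X} (U : set X) (k : nat) : set (phi_space X k) :=
  match k return set (phi_space X k) with
  | 0 => U
  | k'.+1 => [set z : phi_space X k' * X * line K |
      [/\ (z.2 : K) != 0, Phi_def U k' z.1.1 &
          Phi_def U k' (phi_shift ((z.2 : K) *: z.1.2) k' z.1.1)]]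
  end.

(* F is a continuous extension of Phi^k f to U^(k). *)
Definition is_phi {X Y} (U : set X) (f : X -> Y) (k : nat)
    (F : phi_space X k -> Y) : Prop :=
  {within phi_dom U k, continuous F} /\ {in Phi_def U k, F =1 Phi f k}.

(* The two scales: C^n and C^[n]. *)
Inductive scale := Plain | Bracket.

Definition S_space (s : scale) X (k : nat) : ultraNormedModType K :=
  match s with Plain => phi_space X k | Bracket => ups_space X k end.

Definition S_dom (s : scale) {X} (U : set X) (k : nat) : set (S_space s X k) :=
  match s with Plain => phi_dom U k | Bracket => ups_dom U k end.

(* F is S^k f. *)
Definition is_S (s : scale) {X Y} (U : set X) (f : X -> Y) (k : nat) :
    (S_space s X k -> Y) -> Prop :=
  match s with Plain => is_phi U f k | Bracket => is_ups U f k end.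

Definition bounded_unif {X Y} (D : set X) (F : X -> Y) : Prop :=
  forall A, open A -> A `<=` D -> nbounded A ->
    nbounded (F @` A) /\ unif_continuous (F : subspace A -> Y).

(* Orders of smoothness: Some n is n, None is infinity. *)
Definition below (k : nat) (n : option nat) : bool :=
  if n is Some m then (k <= m)%N else true.

Definition order_le (n n' : option nat) : bool :=
  if n is Some m then below m n' else n' == None.

(* Where Phi^k f does not determine its extension to U^(k), one extension is
   required to have all the stated properties. *)
Definition is_S_b (s : scale) {X Y} (U : set X) (f : X -> Y) (k : nat)
    (F : S_space s X k -> Y) : Prop :=
  is_S s U f k F /\ bounded_unif (S_dom s U k) F.

Definition C_b (s : scale) (n : option nat) {X Y} (U : set X) : set (X -> Y) :=
  [set f | forall k, below k n -> exists F, is_S_b s U f k F].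

(* Arguments whose base point lies in P, whose vector increments lie in Q and
   whose scalars have norm at most 1. *)
Fixpoint ups_args {X} (P Q : set X) (k : nat) : set (ups_space X k) :=
  match k return set (ups_space X k) with
  | 0 => P
  | k'.+1 => [set z : ups_space X k' * ups_space X k' * line K |
      [/\ ups_args P Q k' z.1.1, ups_args Q Q k' z.1.2
        & absv (z.2 : K) <= 1]]
  end.

Fixpoint phi_args {X} (P Q : set X) (k : nat) : set (phi_space X k) :=
  match k return set (phi_space X k) with
  | 0 => P
  | k'.+1 => [set z : phi_space X k' * X * line K |
      [/\ phi_args P Q k' z.1.1, Q z.1.2 & absv (z.2 : K) <= 1]]
  end.

Definition S_args (s : scale) {X} (P Q : set X) (k : nat) :
    set (S_space s X k) :=
  match s with Plain => phi_args P Q k | Bracket => ups_args P Q k end.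

Definition C_b_base (s : scale) (n : option nat) {X Y} (U : set X)
    (m : nat) (V : set Y) (P : set X) (y0 : X) : set (X -> Y) :=
  [set f | C_b s n U f /\ forall k, (k <= m)%N ->
     exists2 F, is_S_b s U f k F &
       S_dom s U k `&` S_args s P [set x - y0 | x in P] k `<=` F @^-1` V].

(* Neighborhoods of 0 in C_b, generated by the sets C_b_base. *)
Definition C_b_nbhs0 (s : scale) (n : option nat) {X Y} (U : set X) :
    set (set (X -> Y)) :=
  [set N | exists (q : nat) (m : 'I_q -> nat) (V : 'I_q -> set Y)
      (P : 'I_q -> set X) (y0 : 'I_q -> X),
    (forall a, [/\ below (m a) n, open (V a) /\ V a 0,
       [/\ open (P a), nbounded (P a) & P a `<=` U] & P a (y0 a)]) /\
    C_b s n U `&` \bigcap_a C_b_base s n U (m a) (V a) (P a) (y0 a) `<=` N].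

End smoothness.
Set Implicit Arguments.

Definition lin_indep (F : pzRingType) (V : lmodType F) (I : finType)
    (P : pred I) (u : I -> V) : Prop :=
  forall c : I -> F, \sum_(i | P i) c i *: u i = 0 -> forall i, P i -> c i = 0.

Definition homeo_onto_image (S : ptopologicalType) (T : topologicalType)
    (A : set S) (f : S -> T) : Prop :=
  [/\ {in A &, injective f}, {within A, continuous f} &
      {within f @` A, continuous (pinv A f)}].

Section manifold.
Context {R : realType} {K : valuedFieldType R} (X : ultraNormedModType K).
(* M is nonempty and Lambda is the index set of a finite atlas; M need not be
   Hausdorff.  The base point of M only makes pinv available. *)
Context (M : ptopologicalType) (Lambda : finType).
Context (U : Lambda -> set M) (phi : Lambda -> M -> X).
Implicit Types (s : scale) (n : option nat) (f g : M -> M).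

Let psi i : X -> M := pinv (U i) (phi i).

Record is_atlas s n : Prop := IsAtlas {
  atlas_open : forall i, open (U i) ;
  atlas_cover : \bigcup_i U i = setT ;
  atlas_homeo : forall i, homeo_onto_image (U i) (phi i) ;
  atlas_image : forall i, open (phi i @` U i) ;
  atlas_transition : forall i j,
    C_b s n (phi i @` (U i `&` U j)) (phi j \o psi i)
}.

(* phi_j o f o phi_i^-1 and its domain. *)
Definition rep f i j : X -> X := phi j \o f \o psi i.
Definition rep_dom f i j : set X := phi i @` (U i `&` f @^-1` U j).

Definition C_b_map s n : set (M -> M) :=
  [set f | forall i j, C_b s n (rep_dom f i j) (rep f i j)].

(* The condition on the inverse makes this a group: in characteristic p the
   homeomorphism x |-> x ^+ p of a perfect field is smooth, its inverse is
   not. *)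
Definition Diff s n : set (M -> M) :=
  [set f | exists g, [/\ cancel f g, cancel g f, continuous f, continuous g &
                         C_b_map s n f /\ C_b_map s n g]].

(* O is open in Diff: around each f in O, it contains all the g whose
   representatives are defined where those of f are and differ from them by a
   function close to 0 in C_b. *)
Definition Diff_open s n (O : set (M -> M)) : Prop :=
  O `<=` Diff s n /\
  forall f, O f -> exists N : Lambda -> Lambda -> set (X -> X),
    (forall i j, C_b_nbhs0 s n (rep_dom f i j) (N i j)) /\
    forall g, Diff s n g ->
      (forall i j, rep_dom f i j `<=` rep_dom g i j /\
                   N i j (fun x => rep g i j x - rep f i j x)) -> O g.

Definition one_parameter_subgroup s n (gy : K -> M -> M) : Prop :=
  [/\ forall y, Diff s n (gy y), gy 0 = id &
      forall y1 y2, gy (y1 + y2) = gy y1 \o gy y2].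

End manifold.

(* Main.v *)
Require Import Defs.
From HB Require Import structures.
From mathcomp Require Import all_boot all_order all_algebra.
From mathcomp Require Import boolp classical_sets functions cardinality.
From mathcomp Require Import reals topology.

Import Order.TTheory GRing.Theory Num.Theory.
Local Open Scope classical_set_scope.
Local Open Scope ring_scope.

(** In a one-parameter subgroup indexed by a group of characteristic p, every
    element satisfies g^p = g^(p.1) = g^0 = id.  Hence it suffices to find g with
    g^p <> id near the identity, and to see that linear independence excludes
    g^p = id.

    Linear independence.  If g^p = id, then a_k = iota o g^k is p-periodic in
    k, and u_k = (h - h o g^-1) o g^k is its second difference
    a_(k+1) - 2 a_k + a_(k-1).  Summation by parts over one period gives
    sum_k (k - 1) u_k = 0.  The coefficient of the omitted u_1 vanishes and
    that of u_0 is -1: the remaining u_k are dependent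
    ([second_difference_dependent]).

    Elements of order other than p near the identity.  Choose a point m that
    lies in as many chart domains as possible; then every chart domain either
    contains or misses a fixed neighborhood of m ([exists_generic_point]).  In
    one chart around m, with c the coordinates of m, let g_y be the dilation
    x |-> c + (1 + y)(x - c) of a small ball, extended by the identity
    ([dilate]).  As |1 + y| = 1 for |y| < 1, the ball is preserved, and the
    inverse of g_y is another g_y'.  The map g_y^p is the dilation by
    (1 + y)^p = 1 + y^p, which is not the identity for y <> 0.

    It remains to see that g_y is of class C_b and tends to the identity as y
    tends to 0 ([Diff_dilate], [dilate_near_id]).  In the charts i and j, g_y
    differs from the transition map by [displacement] i j (x, y), a composite
    of transition maps and the dilation that vanishes at y = 0.  Once it is
    smooth in the joint variable (x, y), its iterated difference quotients in
    x are uniformly continuous in (x, y), hence uniformly small for small y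
    ([C_b_family]).

    Joint smoothness needs a chain rule and a cutoff, for both scales.  The
    predicate [smooth] iterates f |-> (f(x + tv) - f(x))/t over t <> 0 only, so
    that the quotients are canonical; extensions to t = 0 are produced at the
    very end from the completeness of the target ([ucb_extend]).  The scales
    differ by the directions in which the next quotient is taken: all of
    (x, v, t) for C^[n], but only (x, v) for C^n.  The scalar t must stay fixed
    in the second case, because in characteristic p bounds on the Phi^k do not
    control quotients in t: an additive map f : K -> K satisfies Phi^2 f = 0,
    whereas the quotients of t |-> f(t)/t need not be bounded.  Quotients in v,
    on the other hand, are again sums of values of Phi^k and Phi^(k+1)
    ([quo_Phi]), and they are what the chain rule requires. *)

Set Implicit Arguments.
Unset Strict Implicit.

(** * Ultranorms *)

Section unorm.
Context {R : realType} {K : valuedFieldType R} {E : ultraNormedModType K}.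
Implicit Types (x y : E) (e : R).

Lemma unorm0 : unorm (0 : E) = 0.
Proof. by rewrite -(scale0r 0) unormZ absv0 mul0r. Qed.

Lemma unormN x : unorm (- x) = unorm x.
Proof. by rewrite -scaleN1r unormZ absvN absv1 mul1r. Qed.

Lemma unormBC x y : unorm (x - y) = unorm (y - x).
Proof. by rewrite -unormN opprB. Qed.

Lemma unormD_lt e x y : unorm x < e -> unorm y < e -> unorm (x + y) < e.
Proof. by move=> hx hy; rewrite (le_lt_trans (unormD _ _))// gt_max hx. Qed.

Lemma unormB_lt e x y : unorm x < e -> unorm y < e -> unorm (x - y) < e.
Proof. by move=> hx hy; apply: unormD_lt => //; rewrite unormN. Qed.

Lemma unormD_le e x y : unorm x <= e -> unorm y <= e -> unorm (x + y) <= e.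
Proof. by move=> hx hy; rewrite (le_trans (unormD _ _))// ge_max hx. Qed.

Lemma unormB_le e x y : unorm x <= e -> unorm y <= e -> unorm (x - y) <= e.
Proof. by move=> hx hy; apply: unormD_le => //; rewrite unormN. Qed.

Lemma unorm_trans_lt y e x z :
  unorm (x - y) < e -> unorm (y - z) < e -> unorm (x - z) < e.
Proof. by move=> hx hy; rewrite -(subrKA y); apply: unormD_lt. Qed.

Lemma unorm_small x : (forall e, 0 < e -> unorm x < e) -> x = 0.
Proof.
move=> h; apply: (@unorm_eq0 R K); apply/eqP; rewrite eq_le unorm_ge0 andbT.
by apply/ler_addgt0Pr => e e0; rewrite add0r ltW// h.
Qed.

End unorm.

Lemma absvV {R : realType} {K : valuedFieldType R} (t : K) :
  absv t^-1 = (absv t)^-1.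
Proof.
have [->|t0] := eqVneq t 0; first by rewrite invr0 absv0 invr0.
apply: (mulIf (_ : absv t != 0)).
  by apply/eqP => /absv_eq0 /eqP; apply/negP.
rewrite -absvM !mulVf ?absv1//.
by apply/eqP => /absv_eq0 /eqP; apply/negP.
Qed.

(** * A calculus of iterated difference quotients *)

Section calculus.
Context {R : realType} {K : valuedFieldType R}.
Implicit Types E F G : ultraNormedModType K.

(** Bounded and uniformly continuous on bounded parts of S.  Boundedness does
    not follow from uniform continuity, not even on a ball. *)
Definition ucb {E F} (S : set E) (f : E -> F) : Prop :=
  forall r : R,
    (exists b : R, forall x, S x -> unorm x <= r -> unorm (f x) <= b) /\
    (forall e : R, 0 < e -> exists2 d : R, 0 < d & forall x y, S x -> S y ->
       unorm x <= r -> unorm y <= r -> unorm (x - y) < d ->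
       unorm (f x - f y) < e).

Definition subm {E} (L : set E) : Prop :=
  L 0 /\ forall (a : K) x y, L x -> L y -> L (a *: x + y).

Definition bounded_linear {E F} (f : E -> F) : Prop :=
  (forall (a : K) x y, f (a *: x + y) = a *: f x + f y) /\
  exists2 c : R, 0 <= c & forall x, unorm (f x) <= c * unorm x.

Definition prodset {E F} (A : set E) (B : set F) : set (E * F)%type :=
  [set u | A u.1 /\ B u.2].

Definition scalar_dir (s : scale) : set (line K) :=
  [set t | s = Plain -> t = 0].

(** Directions for the next quotient of [quo f], when f was differentiated in
    the directions L: the scalar is allowed to move in the bracket scale
    only. *)
Definition dirs (s : scale) {E} (L : set E) : set (E * E * line K)%type :=
  prodset (prodset L L) (scalar_dir s).

Definition quo {E F} (f : E -> F) (z : E * E * line K) : F :=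
  (z.2 : K)^-1 *: (f (z.1.1 + (z.2 : K) *: z.1.2) - f z.1.1).

Definition quo_dom {E} (L S : set E) : set (E * E * line K)%type :=
  [set z | [/\ S z.1.1, L z.1.2, S (z.1.1 + (z.2 : K) *: z.1.2)
             & (z.2 : K) != 0]].

(** The quotients up to order m, in the directions L and at points of S, are
    [ucb], and their values lie in LF.  The last condition makes the chain rule
    work: the values of [quo f] are the directions in which a map composed
    with f gets differentiated. *)
Fixpoint smooth (s : scale) (m : nat) {E F} (LF : set F) (L S : set E)
    (f : E -> F) : Prop :=
  ucb S f /\
  if m is m'.+1 then
    (forall z, quo_dom L S z -> LF (quo f z)) /\
    smooth s m' LF (dirs s L) (quo_dom L S) (quo f)
  else True.

Lemma ucb_eq {E F} (S : set E) (f g : E -> F) :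
  (forall x, S x -> f x = g x) -> ucb S f -> ucb S g.
Proof.
move=> fg uf r; have [[b hb] hu] := uf r; split.
  by exists b => x Sx xr; rewrite -fg//; exact: hb.
move=> e /hu[d d0 hd]; exists d => // x y Sx Sy xr yr xy.
by rewrite -!fg//; exact: hd.
Qed.

Lemma ucb_sub {E F} (S S' : set E) (f : E -> F) :
  S `<=` S' -> ucb S' f -> ucb S f.
Proof.
move=> SS uf r; have [[b hb] hu] := uf r; split.
  by exists b => x /SS Sx xr; exact: hb.
by move=> e /hu[d d0 hd]; exists d => // x y /SS Sx /SS Sy; exact: hd.
Qed.

Lemma bounded_linearD {E F} (f : E -> F) : bounded_linear f ->
  {morph f : x y / x + y}.
Proof. by case=> h _ x y; rewrite -[x]scale1r h !scale1r. Qed.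

Lemma bounded_linear0 {E F} (f : E -> F) : bounded_linear f -> f 0 = 0.
Proof.
by move=> h; apply: (addrI (f 0)); rewrite -bounded_linearD// !addr0.
Qed.

Lemma bounded_linearZ {E F} (f : E -> F) : bounded_linear f ->
  forall (a : K) x, f (a *: x) = a *: f x.
Proof.
by move=> h a x; rewrite -[a *: x]addr0 (proj1 h) bounded_linear0// addr0.
Qed.

Lemma bounded_linearB {E F} (f : E -> F) : bounded_linear f ->
  {morph f : x y / x - y}.
Proof.
by move=> h x y; rewrite bounded_linearD// -scaleN1r bounded_linearZ// scaleN1r.
Qed.

Lemma ucb_lin {E F} (S : set E) (f : E -> F) : bounded_linear f -> ucb S f.
Proof.
move=> hf r; have [_ [c c0 hc]] := hf; split.
  exists (c * r) => x _ xr; rewrite (le_trans (hc _))//.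
  by rewrite ler_wpM2l.
move=> e e0; exists (e / (c + 1)); first by rewrite divr_gt0// ltr_wpDl.
move=> x y _ _ _ _; rewrite -bounded_linearB// ltr_pdivlMr ?ltr_wpDl// => xy.
rewrite (le_lt_trans (hc _))// (le_lt_trans _ xy)// mulrC.
by rewrite ler_wpM2l ?unorm_ge0// lerDl.
Qed.

Lemma ucb_comp {E F G} (S : set E) (T : set F) (f : E -> F) (g : F -> G) :
  (forall x, S x -> T (f x)) -> ucb S f -> ucb T g -> ucb S (g \o f).
Proof.
move=> ST uf ug r; have [[b hb] hu] := uf r.
have [[c hc] hv] := ug b; split.
  by exists c => x Sx xr; apply: hc; [exact: ST|exact: hb].
move=> e /hv[d d0 hd]; have [d' d'0 hd'] := hu _ d0; exists d' => //.
move=> x y Sx Sy xr yr xy; apply: hd; [exact: ST|exact: ST|exact: hb|exact: hb|].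
exact: hd'.
Qed.

Lemma unorm_pair_le {E F} (u : E * F) (r : R) :
  (unorm u <= r) = (unorm u.1 <= r) && (unorm u.2 <= r).
Proof. by rewrite [LHS]ge_max. Qed.

Lemma unorm_pair_lt {E F} (u : E * F) (r : R) :
  (unorm u < r) = (unorm u.1 < r) && (unorm u.2 < r).
Proof. by rewrite [LHS]gt_max. Qed.

Lemma ucb_pair {E F G} (S : set E) (f : E -> F) (g : E -> G) :
  ucb S f -> ucb S g -> ucb S (fun x => (f x, g x) : (F * G)%type).
Proof.
move=> uf ug r; have [[b hb] hu] := uf r; have [[c hc] hv] := ug r; split.
  exists (Num.max b c) => x Sx xr; rewrite unorm_pair_le/= !le_max.
  by rewrite hb// hc// orbT.
move=> e e0; have [d d0 hd] := hu e e0; have [d' d'0 hd'] := hv e e0.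
exists (Num.min d d'); first by rewrite lt_min d0.
move=> x y Sx Sy xr yr; rewrite lt_min => /andP[xy xy'].
by rewrite unorm_pair_lt/= hd// hd'.
Qed.

Lemma ucb_cst {E F} (S : set E) (c : F) : ucb S (fun=> c).
Proof.
move=> r; split; first by exists (unorm c).
by move=> e e0; exists 1 => // x y *; rewrite subrr unorm0.
Qed.

Lemma ucb_scale {E F} (S : set E) (a : E -> line K) (f : E -> F) :
  ucb S a -> ucb S f -> ucb S (fun x => (a x : K) *: f x).
Proof.
move=> uf ug r; have [[b hb] hu] := uf r; have [[c hc] hv] := ug r; split.
  exists (b * c) => x Sx xr; rewrite unormZ ler_pM ?absv_ge0 ?unorm_ge0//.
    exact: hb.
  exact: hc.
move=> e e0.
pose B := Num.max 1 (Num.max b c).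
have B0 : 0 < B by rewrite lt_max ltr01.
have eB : 0 < e / B by rewrite divr_gt0.
have [d d0 hd] := hu _ eB; have [d' d'0 hd'] := hv _ eB.
exists (Num.min d d'); first by rewrite lt_min d0.
move=> x y Sx Sy xr yr; rewrite lt_min => /andP[xy xy'].
rewrite (_ : _ - _ = ((a x : K) *: (f x - f y)) + ((a x - a y : K) *: f y)); last first.
  by rewrite scalerBr scalerBl addrA subrK.
have ax : absv (a x : K) <= B by rewrite (le_trans (hb x Sx xr))// !le_max lexx !orbT.
have fy : unorm (f y) <= B by rewrite (le_trans (hc y Sy yr))// !le_max lexx !orbT.
apply: unormD_lt; rewrite unormZ.
  rewrite (le_lt_trans (ler_wpM2r (unorm_ge0 _) ax))//.
  by rewrite mulrC -ltr_pdivlMr// hd'.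
rewrite (le_lt_trans (ler_wpM2l (absv_ge0 _) fy))//.
by rewrite -ltr_pdivlMr//; exact: hd.
Qed.

Definition bounded_below {E} (S : set E) (a : E -> line K) : Prop :=
  forall r : R, exists2 h : R, 0 < h &
    forall x, S x -> unorm x <= r -> h <= absv (a x : K).

Lemma ucb_inv {E} (S : set E) (a : E -> line K) :
  ucb S a -> bounded_below S a ->
  ucb S (fun x => (a x : K)^-1 : line K).
Proof.
move=> uf ba r; have [_ hu] := uf r; have [h h0 hh] := ba r; split.
  exists h^-1 => x Sx xr; rewrite [leLHS]absvV lef_pV2 ?posrE//; first exact: hh.
  exact: lt_le_trans h0 (hh _ Sx xr).
move=> e e0.
have e' : 0 < e * (h * h) by rewrite !mulr_gt0.
have [d d0 hd] := hu _ e'; exists d => // x y Sx Sy xr yr /(hd _ _ Sx Sy xr yr) xy.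
have hx := hh _ Sx xr; have hy := hh _ Sy yr.
have x0 : (a x : K) != 0.
  by apply: contraTneq hx => ->; rewrite absv0 -ltNge.
have y0 : (a y : K) != 0.
  by apply: contraTneq hy => ->; rewrite absv0 -ltNge.
rewrite (_ : _ - _ = ((a x : K)^-1 * (a y : K)^-1) *: (a y - a x)); last first.
  rewrite [RHS]mulrBr; congr (_ - _).
    by rewrite -mulrA mulVf// mulr1.
  by rewrite [X in X * _]mulrC -mulrA mulVf// mulr1.
rewrite unormZ absvM !absvV -invfM mulrC ltr_pdivrMr; last first.
  by rewrite mulr_gt0// (lt_le_trans h0).
rewrite unormBC (lt_le_trans xy)// (ler_wpM2l (ltW e0))//.
by rewrite ler_pM// ltW.
Qed.

End calculus.

Section smooth_calculus.
Context {R : realType} {K : valuedFieldType R} (s : scale).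
Implicit Types E F G : ultraNormedModType K.

Lemma smooth_ucb m {E F} (LF : set F) (L S : set E) (f : E -> F) :
  smooth s m LF L S f -> ucb S f.
Proof. by case: m => [|m] []. Qed.

Lemma smooth_eq m {E F} (LF : set F) (L S : set E) (f g : E -> F) :
  (forall x, S x -> f x = g x) -> smooth s m LF L S f -> smooth s m LF L S g.
Proof.
elim: m E LF L S f g => [|m IH] E LF L S f g fg.
  by case=> uf _; split => //; exact: ucb_eq uf.
case=> uf [hL hq]; split; first exact: ucb_eq uf.
have fgq z : quo_dom L S z -> quo f z = quo g z.
  by case=> h1 _ h2 _; rewrite /quo !fg.
by split=> [z hz|]; [rewrite -fgq//; exact: hL|exact: IH hq].
Qed.

Lemma smooth_sub m {E F} (LF : set F) (L S L' S' : set E) (f : E -> F) :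
  L `<=` L' -> S `<=` S' -> smooth s m LF L' S' f -> smooth s m LF L S f.
Proof.
elim: m E LF L S L' S' f => [|m IH] E LF L S L' S' f LL SS.
  by case=> uf _; split => //; exact: ucb_sub uf.
case=> uf [hL hq]; split; first exact: ucb_sub uf.
have dd : quo_dom L S `<=` quo_dom L' S'.
  by move=> z [h1 h2 h3 h4]; split => //; [exact: SS|exact: LL|exact: SS].
split=> [z /dd /hL//|]; apply: IH hq => //.
by move=> z [[h1 h2] h3]; split => //; split; exact: LL.
Qed.

Lemma smoothW m {E F} (LF : set F) (L S : set E) (f : E -> F) :
  smooth s m.+1 LF L S f -> smooth s m LF L S f.
Proof.
elim: m E LF L S f => [|m IH] E LF L S f; first by case.
by move=> [uf [hL hq]]; split => //; split => //; exact: IH.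
Qed.

Lemma bounded_linear_fst {E F} : bounded_linear (fst : E * F -> E).
Proof.
split; first by [].
by exists 1 => // u; rewrite mul1r [leRHS]/unorm/= le_max lexx.
Qed.

Lemma bounded_linear_snd {E F} : bounded_linear (snd : E * F -> F).
Proof.
split; first by [].
by exists 1 => // u; rewrite mul1r [leRHS]/unorm/= le_max lexx orbT.
Qed.

Lemma bounded_linear_id {E} : bounded_linear (id : E -> E).
Proof. by split => //; exists 1 => // x; rewrite mul1r. Qed.

Lemma bounded_linear_cst0 {E F} : bounded_linear ((fun=> 0) : E -> F).
Proof.
split; first by move=> a x y; rewrite scaler0 addr0.
by exists 0 => // x; rewrite mul0r unorm0.
Qed.

Lemma bounded_linear_comp {E F G} (f : E -> F) (g : F -> G) :
  bounded_linear f -> bounded_linear g -> bounded_linear (fun x => g (f x)).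
Proof.
move=> [lf [c c0 hc]] [lg [d d0 hd]]; split=> [a x y|].
  by rewrite lf lg.
exists (d * c); first exact: mulr_ge0.
by move=> x; rewrite (le_trans (hd _))// -mulrA ler_wpM2l.
Qed.

Lemma bounded_linear_fst2 {E F G} :
  bounded_linear (fun u : E * F * G => u.1.1).
Proof. exact: (bounded_linear_comp bounded_linear_fst bounded_linear_fst). Qed.

Lemma bounded_linear_fst_snd {E F G} :
  bounded_linear (fun u : E * F * G => u.1.2).
Proof. exact: (bounded_linear_comp bounded_linear_fst bounded_linear_snd). Qed.

Lemma bounded_linear_pair {E F G} (f : E -> F) (g : E -> G) :
  bounded_linear f -> bounded_linear g ->
  bounded_linear (fun x => (f x, g x) : (F * G)%type).
Proof.
move=> [lf [c c0 hc]] [lg [d d0 hd]]; split=> [a x y|].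
  by rewrite lf lg.
exists (Num.max c d) => [|x]; first by rewrite le_max c0.
rewrite unorm_pair_le/=; apply/andP; split.
  by rewrite (le_trans (hc _))// ler_wpM2r ?unorm_ge0// le_max lexx.
by rewrite (le_trans (hd _))// ler_wpM2r ?unorm_ge0// le_max lexx orbT.
Qed.

Lemma bounded_linear_add {E} : bounded_linear (fun u : E * E => u.1 + u.2).
Proof.
split=> [a x y|]; first by rewrite /= scalerDr addrACA.
by exists 1 => // u; rewrite mul1r unormD.
Qed.

Lemma bounded_linear_opp {E} : bounded_linear (fun u : E => - u).
Proof.
split=> [a x y|]; first by rewrite opprD scalerN.
by exists 1 => // u; rewrite mul1r unormN.
Qed.

Hint Resolve bounded_linear_fst bounded_linear_snd bounded_linear_id
  bounded_linear_cst0 : core.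

Lemma quo_lin {E F} (f : E -> F) (z : E * E * line K) : bounded_linear f ->
  (z.2 : K) != 0 -> quo f z = f z.1.2.
Proof.
move=> hf z0; rewrite /quo (bounded_linearD hf) (bounded_linearZ hf) addrAC subrr add0r.
by rewrite scalerA mulVf// scale1r.
Qed.

Lemma smooth_lin m {E F} (LF : set F) (L S : set E) (f : E -> F) :
  bounded_linear f -> (forall x, L x -> LF (f x)) -> smooth s m LF L S f.
Proof.
elim: m E LF L S f => [|m IH] E LF L S f hf LL.
  by split => //; exact: ucb_lin.
split; first exact: ucb_lin.
split=> [z [h1 h2 h3 h4]|]; first by rewrite quo_lin//; exact: LL.
apply: (@smooth_eq _ _ _ _ _ _ (fun z => f z.1.2)).
  by move=> z [h1 h2 h3 h4]; rewrite quo_lin.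
apply: IH => [|z [[h1 h2] h3]]; last exact: LL.
exact: (bounded_linear_comp bounded_linear_fst_snd hf).
Qed.

Lemma smooth_precomp m {E E' F} (LF : set F) (L S : set E) (L' S' : set E')
    (l : E' -> E) (f : E -> F) :
  bounded_linear l -> (forall x, L' x -> L (l x)) ->
  (forall x, S' x -> S (l x)) -> smooth s m LF L S f ->
  smooth s m LF L' S' (fun x => f (l x)).
Proof.
elim: m E E' LF L S L' S' l f => [|m IH] E E' LF L S L' S' l f hl LL SS.
  by case=> uf _; split => //; apply: ucb_comp uf; [exact: SS|exact: ucb_lin].
case=> uf [hL hq]; split.
  by apply: ucb_comp uf; [exact: SS|exact: ucb_lin].
pose l' (z : E' * E' * line K) : (E * E * line K)%type :=
  (l z.1.1, l z.1.2, z.2).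
have ql z : quo (fun x => f (l x)) z = quo f (l' z).
  by rewrite /quo /= (bounded_linearD hl) (bounded_linearZ hl).
have l'd z : quo_dom L' S' z -> quo_dom L S (l' z).
  case=> h1 h2 h3 h4; split => //=; [exact: SS|exact: LL|].
  by rewrite -(bounded_linearZ hl) -(bounded_linearD hl); exact: SS.
split=> [z hz|]; first by rewrite ql; apply/hL/l'd.
apply: (@smooth_eq _ _ _ _ _ _ (fun z => quo f (l' z))) => //.
apply: IH hq => //; last by move=> z [[h1 h2] h3]; do !split => //; exact: LL.
apply: bounded_linear_pair => //; apply: bounded_linear_pair.
  exact: (bounded_linear_comp bounded_linear_fst2 hl).
exact: (bounded_linear_comp bounded_linear_fst_snd hl).
Qed.

Lemma smooth_base m {E F} (LF : set F) (L S : set E) (f : E -> F) :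
  smooth s m.+1 LF L S f ->
  smooth s m LF (dirs s L) (quo_dom L S) (fun z => f z.1.1).
Proof.
move=> sf; apply: smooth_precomp (smoothW sf) => [|x|x].
- exact: bounded_linear_fst2.
- by case=> [[]].
- by case.
Qed.

Lemma smooth_pair m {E F G} (LF : set F) (LG : set G) (L S : set E)
    (f : E -> F) (g : E -> G) :
  smooth s m LF L S f -> smooth s m LG L S g ->
  smooth s m (prodset LF LG) L S (fun x => (f x, g x) : (F * G)%type).
Proof.
elim: m E L S f g => [|m IH] E L S f g.
  by case=> uf _ [ug _]; split => //; exact: ucb_pair.
case=> uf [hL hq] [ug [hL' hq']]; split; first exact: ucb_pair.
split=> [z hz|]; first by split; [exact: hL|exact: hL'].
by apply: smooth_eq (IH _ _ _ _ _ hq hq').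
Qed.

(** Chain rule, from the identity
    quo (g o f) (x, v, t) = quo g (f x, quo f (x, v, t), t). *)
Lemma smooth_comp m {E F G} (LF : set F) (LG : set G) (L S : set E)
    (T : set F) (f : E -> F) (g : F -> G) :
  (forall x, S x -> T (f x)) ->
  smooth s m LF L S f -> smooth s m LG LF T g ->
  smooth s m LG L S (fun x => g (f x)).
Proof.
elim: m E F G LF LG L S T f g => [|m IH] E F G LF LG L S T f g ST.
  by case=> uf _ [ug _]; split => //; exact: ucb_comp ug.
move=> sf; have := sf.
case=> uf [hL hq] [ug [hL' hq']]; split; first exact: ucb_comp ug.
pose f' (z : E * E * line K) : (F * F * line K)%type :=
  (f z.1.1, quo f z, z.2).
have ff z : quo_dom L S z ->
    f z.1.1 + (z.2 : K) *: quo f z = f (z.1.1 + (z.2 : K) *: z.1.2).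
  by case=> _ _ _ h4; rewrite /quo scalerA mulfV// scale1r addrCA subrr addr0.
have f'd z : quo_dom L S z -> quo_dom LF T (f' z).
  move=> hz; case: (hz) => h1 h2 h3 h4; split => //=; [exact: ST|exact: hL|].
  by rewrite ff//; exact: ST.
have qf z : quo_dom L S z -> quo g (f' z) = quo (fun x => g (f x)) z.
  by move=> hz; rewrite [LHS]/quo [f' _]/f' [_.1.1]/= ff.
split=> [z hz|]; first by rewrite -qf//; apply/hL'/f'd.
apply: smooth_eq qf _; apply: IH hq' => //.
apply: smooth_pair.
  by apply: smooth_pair => //; exact: smooth_base.
by apply: smooth_lin => // x [_ h].
Qed.

Lemma smooth_add m {E F} (LF : set F) (L S : set E) (f g : E -> F) :
  subm LF -> smooth s m LF L S f -> smooth s m LF L S g ->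
  smooth s m LF L S (fun x => f x + g x).
Proof.
move=> [_ hLF] sf sg.
apply: (smooth_comp (T := setT) _ (smooth_pair sf sg)
  (smooth_lin _ _ (@bounded_linear_add F) _)) => //= u [h1 h2].
by rewrite -[u.1]scale1r; exact: hLF.
Qed.

Lemma subm_opp {F : ultraNormedModType K} (LF : set F) x :
  subm LF -> LF x -> LF (- x).
Proof. by case=> h0 h hx; rewrite -scaleN1r -[_ *: _]addr0; exact: h. Qed.

Lemma smooth_opp m {E F} (LF : set F) (L S : set E) (f : E -> F) :
  subm LF -> smooth s m LF L S f -> smooth s m LF L S (fun x => - f x).
Proof.
move=> hLF sf.
apply: (smooth_comp (T := setT) _ sf
  (smooth_lin _ _ (@bounded_linear_opp F) _)) => //= u.
exact: subm_opp.
Qed.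

Lemma smooth_cst m {E F} (LF : set F) (L S : set E) (c : F) :
  LF 0 -> smooth s m LF L S (fun=> c).
Proof.
move=> h0; case: m => [|m]; first by split => //; exact: ucb_cst.
split; first exact: ucb_cst.
have q0 z : quo (fun=> c) z = 0 :> F by rewrite /quo subrr scaler0.
split=> [z _|]; first by rewrite q0.
by apply: smooth_eq (smooth_lin _ _ bounded_linear_cst0 _).
Qed.

(** Functions that do not vary along L have zero quotients; in the plain scale
    this applies to any expression in the scalars alone. *)
Lemma smooth_param m {E F} (LF : set F) (L S : set E) (f : E -> F) :
  LF 0 -> ucb S f ->
  (forall x v (t : K), S x -> L v -> S (x + t *: v) -> f (x + t *: v) = f x) ->
  smooth s m LF L S f.
Proof.
move=> h0 uf hf; case: m => [|m]; first by split.
have q0 z : quo_dom L S z -> 0 = quo f z.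
  by case=> h1 h2 h3 _; rewrite /quo hf// subrr scaler0.
split => //; split=> [z /q0 <-//|].
by apply: smooth_eq q0 _; apply: smooth_cst.
Qed.

Lemma subT {F : ultraNormedModType K} : subm [set: F].
Proof. by []. Qed.

Lemma subm_dirs {E} (L : set E) : subm L -> subm (dirs s L).
Proof.
move=> [h0 h]; split; first by do !split.
move=> a x y hx hy; case: hx hy => [[h1 h2] h3] [[h1' h2'] h3'].
split; first by split; exact: h.
by move=> sP; rewrite /= h3// h3'// scaler0 addr0.
Qed.

(** Leibniz rule, in the form
    quo (a f) = (quo a) f(x) + a(x) (quo f) + t (quo a) (quo f),
    whose right-hand side only involves the base point x. *)
Lemma smooth_scale m {E F} (LF : set F) (L S : set E)
    (a : E -> line K) (f : E -> F) :
  subm LF -> (forall x, S x -> LF (f x)) ->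
  smooth s m setT L S a -> smooth s m LF L S f ->
  smooth s m LF L S (fun x => (a x : K) *: f x).
Proof.
move=> hLF; elim: m E L S a f => [|m IH] E L S a f fLF.
  by case=> ua _ [uf _]; split => //; exact: ucb_scale.
move=> sa sf; have := sf; have := sa.
case=> ua [_ hq] [uf [hL hq']]; split; first exact: ucb_scale.
have LFZ (c : K) x : LF x -> LF (c *: x).
  by move=> hx; rewrite -[_ *: _]addr0; apply: hLF.2 => //; exact: hLF.1.
have LFD x y : LF x -> LF y -> LF (x + y).
  by move=> hx hy; rewrite -[x]scale1r; exact: hLF.2.
pose q z := ((quo a z : K) *: f z.1.1 + (a z.1.1 : K) *: quo f z) +
  (quo a z : K) *: ((z.2 : K) *: quo f z).
have qE z : quo_dom L S z -> q z = quo (fun x => (a x : K) *: f x) z.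
  case=> h1 h2 h3 h4; rewrite /q /quo.
  set x := z.1.1; set y := (x + _); set t : K := z.2.
  have -> : t *: (t^-1 *: (f y - f x)) = f y - f x.
    by rewrite scalerA mulfV// scale1r.
  rewrite [(t^-1 *: (a y - a x) : K)](_ : _ = t^-1 * (a y - a x : K))//.
  rewrite addrAC -scalerDr (addrC (f x)) subrK.
  rewrite (scalerA (a x) t^-1) (mulrC (a x) t^-1) -!scalerA -scalerDr.
  by rewrite scalerBl scalerBr addrA subrK.
split.
  move=> z hz; rewrite -qE// /q; case: (hz) => h1 h2 h3 h4.
  have LFq := hL z hz.
  by apply/LFD; [apply/LFD; apply/LFZ => //; exact: fLF|do 2!apply/LFZ].
apply: smooth_eq qE _.
apply: smooth_add => //; first apply: smooth_add => //.
- by apply: (IH) => // [z [h1 _ _ _]|]; [exact: fLF|exact: smooth_base].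
- by apply: (IH) => //; exact: smooth_base.
- apply: (IH) => // [z hz|]; first by apply/LFZ/hL.
  apply: (IH) => //; exact: smooth_lin.
Qed.

(** quo (1/a) = - (quo a) / (a(x) a(x + tv)), where
    a(x + tv) = a(x) + t (quo a) on the domain of the quotient. *)
Lemma smooth_inv m {E} (L S : set E) (a : E -> line K) :
  smooth s m setT L S a -> bounded_below S a ->
  smooth s m setT L S (fun x => (a x : K)^-1 : line K).
Proof.
elim: m E L S a => [|m IH] E L S a.
  by case=> ua _ ba; split => //; exact: ucb_inv.
move=> sa ba; have := sa; case=> ua [_ hq]; split; first exact: ucb_inv.
split => //.
have n0 x : S x -> (a x : K) != 0.
  move=> Sx; have [h h0 hh] := ba (unorm x).
  by have := hh _ Sx (lexx _); apply: contraTneq => ->; rewrite absv0 -ltNge.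
pose ay (z : E * E * line K) : line K :=
  a z.1.1 + ((z.2 : K) *: quo a z).
have ayE z : quo_dom L S z -> ay z = a (z.1.1 + (z.2 : K) *: z.1.2).
  by case=> _ _ _ h4; rewrite /ay /quo scalerA mulfV// scale1r addrCA subrr addr0.
pose q (z : E * E * line K) : line K :=
  ((a z.1.1 : K)^-1 : K) *: (((ay z : K)^-1 : K) *: (- quo a z)).
apply: (@smooth_eq _ _ _ _ _ _ q).
  move=> z hz; rewrite /q ayE// /quo.
  case: hz => h1 h2 h3 h4.
  set x := z.1.1 in h1 h3 *; set y := (x + _) in h3 *; set t : K := z.2.
  have x0 := n0 _ h1; have y0 := n0 _ h3.
  rewrite -scalerN opprB.
  transitivity (t^-1 * ((a y : K)^-1 - (a x : K)^-1)) => //.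
  transitivity ((a x : K)^-1 * ((a y : K)^-1 * (t^-1 * ((a x : K) - (a y : K))))) => //.
  rewrite mulrCA [(a x : K)^-1 * (t^-1 * _)]mulrCA mulrCA; congr (_ * _).
  rewrite !mulrBr mulVf// mulr1 mulrCA mulVf//.
  by rewrite mulr1.
apply: smooth_scale => //.
  apply: (IH); first exact: smooth_base.
  move=> r; have [h h0 hh] := ba r; exists h => // z [h1 _ _ _].
  by rewrite unorm_pair_le => /andP[]; rewrite unorm_pair_le => /andP[? _] _; exact: hh.
apply: smooth_scale => //; last exact: smooth_opp.
apply: (IH).
  apply: smooth_add => //; first exact: smooth_base.
  by apply: smooth_scale => //; exact: smooth_lin.
move=> r; pose r' := Num.max r (r * r); have [h h0 hh] := ba r'; exists h => // z hz.
rewrite ayE//; case: hz => h1 h2 h3 h4; rewrite !unorm_pair_le.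
move=> /andP[/andP[xr vr] tr]; apply: hh => //.
rewrite (le_trans (unormD _ _))// ge_max !le_max xr/= unormZ.
by rewrite ler_pM ?absv_ge0 ?unorm_ge0 ?orbT.
Qed.

End smooth_calculus.
#[export] Hint Resolve bounded_linear_fst bounded_linear_snd bounded_linear_id
  bounded_linear_cst0 subT : core.

(** * Cutting off along uniformly clopen sets *)

Section cutoff.
Context {R : realType} {K : valuedFieldType R}.
Implicit Types E F G : ultraNormedModType K.

(** Points of T at a small distance lie both in S or both outside S; the
    distance may depend on a bound for their norms. *)
Definition uclopen {E} (T S : set E) : Prop :=
  forall r : R, exists2 d : R, 0 < d & forall x y, T x -> T y ->
    unorm x <= r -> unorm y <= r -> unorm (x - y) < d -> S x -> S y.

Definition cut {E F} (S : set E) (f : E -> F) (x : E) : F :=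
  if `[< S x >] then f x else 0.

Lemma cut_in {E F} (S : set E) (f : E -> F) x : S x -> cut S f x = f x.
Proof. by move=> Sx; rewrite /cut asboolT. Qed.

Lemma cut_out {E F} (S : set E) (f : E -> F) x : ~ S x -> cut S f x = 0.
Proof. by move=> Sx; rewrite /cut asboolF. Qed.

Lemma uclopenI {E} (T S S' : set E) :
  uclopen T S -> uclopen T S' -> uclopen T (S `&` S').
Proof.
move=> h h' r; have [d d0 hd] := h r; have [d' d'0 hd'] := h' r.
exists (Num.min d d'); first by rewrite lt_min d0.
move=> x y Tx Ty xr yr; rewrite lt_min => /andP[xy xy'] [Sx S'x].
by split; [exact: hd Sx|exact: hd' S'x].
Qed.

Lemma uclopenC {E} (T S : set E) : uclopen T S -> uclopen T (~` S).
Proof.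
move=> h r; have [d d0 hd] := h r; exists d => // x y Tx Ty xr yr xy nSx Sy.
by apply: nSx; apply: hd Sy => //; rewrite unormBC.
Qed.

Lemma uclopen_eq {E} (T S S' : set E) :
  (forall x, T x -> S x <-> S' x) -> uclopen T S -> uclopen T S'.
Proof.
move=> SS h r; have [d d0 hd] := h r; exists d => // x y Tx Ty xr yr xy.
by move=> /(SS _ Tx) Sx; apply/(SS _ Ty); exact: hd Sx.
Qed.

Lemma uclopen_preim {E F} (T S : set E) (T' : set F) (h : F -> E) :
  (forall x, T' x -> T (h x)) -> ucb T' h -> uclopen T S ->
  uclopen T' (h @^-1` S).
Proof.
move=> TT uh cS r; have [[b hb] hu] := uh r; have [d d0 hd] := cS b.
have [d' d'0 hd'] := hu _ d0; exists d' => // x y T'x T'y xr yr xy.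
by apply: hd; [exact: TT|exact: TT|exact: hb|exact: hb|exact: hd'].
Qed.

Lemma ucb_cut {E F} (T S : set E) (f : E -> F) :
  uclopen T S -> ucb S f -> ucb T (cut S f).
Proof.
move=> cS uf r; have [[b hb] hu] := uf r; split.
  exists (Num.max 0 b) => x Tx xr; rewrite /cut; case: asboolP => Sx.
    by rewrite le_max hb ?orbT.
  by rewrite unorm0 le_max lexx.
have [d d0 hd] := cS r.
move=> e e0; have [d' d'0 hd'] := hu _ e0; exists (Num.min d d').
  by rewrite lt_min d0.
move=> x y Tx Ty xr yr; rewrite lt_min => /andP[xy xy'].
rewrite /cut; case: asboolP => Sx.
  have Sy : S y by exact: hd Sx.
  by rewrite asboolT//; exact: hd'.
rewrite asboolF ?subrr ?unorm0// => Sy; apply: Sx.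
by apply: hd Sy => //; rewrite unormBC.
Qed.

Lemma smooth_shift s m {E} (L T : set E) : subm L ->
  smooth s m L (dirs s L) (quo_dom L T)
    (fun z : E * E * line K => z.1.1 + (z.2 : K) *: z.1.2).
Proof.
move=> hL; apply: smooth_add => //.
  by apply: smooth_lin; [exact: bounded_linear_fst2|case=> -[? ?] ? [[]]].
apply: smooth_scale => //; first by move=> z [].
  exact: smooth_lin.
by apply: smooth_lin; [exact: bounded_linear_fst_snd|case=> -[? ?] ? [[]]].
Qed.

(** Extension by zero from a uniformly clopen set.  The quotient of the
    extension is the quotient of f where x and x + tv both lie in S, zero where
    neither does, and +-f/t where exactly one does.  In the last case x and
    x + tv are far apart, so that t is bounded away from zero and 1/t is
    smooth.  The four cases are themselves separated by uniformly clopen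
    sets. *)
Lemma smooth_cut s m {E F} (L T S : set E) (f : E -> F) :
  subm L -> uclopen T S -> smooth s m setT L S f ->
  smooth s m setT L T (cut S f).
Proof.
elim: m E L T S f => [|m IH] E L T S f hL cS.
  by case=> uf _; split => //; exact: ucb_cut.
move=> sf; have [uf [_ sq]] := sf; split; first exact: ucb_cut.
split => //.
pose D := quo_dom L T.
pose al (z : E * E * line K) := z.1.1 + (z.2 : K) *: z.1.2.
have ual : ucb D al by exact: smooth_ucb (@smooth_shift s 0 _ _ _ hL).
have u1 : ucb D (fun z : E * E * line K => z.1.1).
  by apply: ucb_lin; exact: bounded_linear_fst2.
have c1 : uclopen D ((fun z : E * E * line K => z.1.1) @^-1` S).
  by apply: uclopen_preim u1 cS => z [].
have c2 : uclopen D (al @^-1` S).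
  by apply: uclopen_preim ual cS => z [].
pose S10 := D `&` [set z | S z.1.1 /\ ~ S (al z)].
pose S01 := D `&` [set z | ~ S z.1.1 /\ S (al z)].
have c11 : uclopen D (quo_dom L S).
  apply: uclopen_eq (uclopenI c1 c2) => z [h1 h2 h3 h4].
  by split=> [[]|[]].
have c10 : uclopen D S10.
  apply: uclopen_eq (uclopenI c1 (uclopenC c2)) => z hz.
  by split=> [[]|[_ []]].
have c01 : uclopen D S01.
  apply: uclopen_eq (uclopenI (uclopenC c1) c2) => z hz.
  by split=> [[]|[_ []]].
pose tinv (z : E * E * line K) : line K := (z.2 : K)^-1.
have stinv S' : S' `<=` D -> (forall z, S' z -> S z.1.1 <-> ~ S (al z)) ->
    smooth s m setT (dirs s L) S' tinv.
  move=> S'D S'S; apply: smooth_inv; first exact: smooth_lin.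
  move=> r; have [d d0 hd] := cS (Num.max r (r * r)).
  exists (d / (`|r| + 1)); first by rewrite divr_gt0// ltr_wpDl.
  move=> z S'z; have [h1 h2 h3 h4] := S'D _ S'z.
  rewrite !unorm_pair_le => /andP[/andP[xr vr] tr].
  have ar : unorm (al z) <= Num.max r (r * r).
    rewrite (le_trans (unormD _ _))// ge_max !le_max xr/= unormZ.
    by rewrite ler_pM ?absv_ge0 ?unorm_ge0 ?orbT.
  have xr' : unorm z.1.1 <= Num.max r (r * r) by rewrite le_max xr.
  have : d <= unorm (al z - z.1.1).
    rewrite leNgt; apply/negP => ax; have xa := ax; rewrite unormBC in xa.
    have [a b] := S'S _ S'z.
    have aS : S z.1.1 -> S (al z) by exact: hd.
    have Sa : S (al z) -> S z.1.1 by exact: hd.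
    by have [Sz|/b nSz] := pselect (S (al z)); [exact: (a (Sa Sz))|apply/a/aS].
  rewrite /al addrAC subrr add0r unormZ => dtv.
  rewrite ler_pdivrMr ?ltr_wpDl//; apply: le_trans dtv _.
  by rewrite ler_wpM2l ?absv_ge0// (le_trans vr)// ler_wpDr// ler_norm.
pose f10 z := - ((tinv z : K) *: f z.1.1).
pose f01 z := (tinv z : K) *: f (al z).
apply: (@smooth_eq _ _ _ _ _ _ _ _ _ (fun z =>
  cut (quo_dom L S) (quo f) z + (cut S10 f10 z + cut S01 f01 z))).
  move=> z hz; rewrite /quo -/(al z).
  have [Sx|Sx] := pselect (S z.1.1); have [Sa|Sa] := pselect (S (al z)).
  - rewrite (@cut_in _ _ (quo_dom L S)); last by case: hz.
    rewrite (@cut_out _ _ S10); last by case=> _ [].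
    rewrite (@cut_out _ _ S01); last by case=> _ [].
    by rewrite !addr0 !cut_in.
  - rewrite (@cut_out _ _ (quo_dom L S)); last by case.
    rewrite (@cut_in _ _ S10)//.
    rewrite (@cut_out _ _ S01); last by case=> _ [].
    by rewrite add0r addr0 (cut_in _ Sx) (cut_out _ Sa) sub0r scalerN.
  - rewrite (@cut_out _ _ (quo_dom L S)); last by case.
    rewrite (@cut_in _ _ S01)//.
    rewrite (@cut_out _ _ S10); last by case=> _ [].
    by rewrite !add0r (cut_in _ Sa) (cut_out _ Sx) subr0.
  - rewrite (@cut_out _ _ (quo_dom L S)); last by case.
    rewrite (@cut_out _ _ S10); last by case=> _ [].
    rewrite (@cut_out _ _ S01); last by case=> _ [].
    by rewrite !addr0 (cut_out _ Sx) (cut_out _ Sa) subr0 scaler0.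
have hdL := subm_dirs s hL.
apply: smooth_add => //; first exact: (IH).
apply: smooth_add => //; apply: (IH) => //.
  apply: smooth_opp => //; apply: smooth_scale => //.
    by apply: stinv => z [hz [h1 h2]].
  apply: (smooth_precomp (L := L) (S := S)); last exact: smoothW.
  - exact: bounded_linear_fst2.
  - by move=> z [[]].
  - by move=> z [hz []].
apply: smooth_scale => //.
  by apply: stinv => z [hz [h1 h2]].
apply: (smooth_comp (T := S)); last exact: smoothW sf.
  by move=> z [hz []].
by apply: smooth_sub (@smooth_shift s m _ _ T hL) => // z [].
Qed.

End cutoff.

(** * Continuity, openness and boundedness in terms of the norm *)

Section bridge.
Context {R : realType} {K : valuedFieldType R}.
Implicit Types E F G : ultraNormedModType K.

Lemma nbhs_unorm {E} (x : E) (A : set E) :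
  nbhs x A <-> exists2 e : R, 0 < e & forall y, unorm (x - y) < e -> A y.
Proof.
split=> [/nbhs_ballP[e /= e0 h]|[e e0 h]].
  by exists e => // y xy; apply: h; rewrite unorm_ball.
by apply/nbhs_ballP; exists e => //= y; rewrite unorm_ball; exact: h.
Qed.

Lemma open_unorm {E} (A : set E) :
  open A <->
  forall x, A x -> exists2 e : R, 0 < e & forall y, unorm (x - y) < e -> A y.
Proof.
rewrite openE; split=> h x Ax; first exact/nbhs_unorm/h.
by apply/nbhs_unorm; exact: h.
Qed.

Lemma within_continuous_unorm {E F} (A : set E) (f : E -> F) :
  {within A, continuous f} <->
  forall x (e : R), A x -> 0 < e -> exists2 d : R, 0 < d &
    forall y, A y -> unorm (x - y) < d -> unorm (f x - f y) < e.
Proof.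
split.
  move=> /subspace_continuousP h x e Ax e0.
  have : nbhs (f x) [set z | unorm (f x - z) < e].
    by apply/nbhs_unorm; exists e.
  move=> /(h x Ax); rewrite /fmap/= /within/= => /nbhs_unorm[d d0 hd].
  by exists d => // y Ay /hd; exact.
move=> h; apply/subspace_continuousP => x Ax B /nbhs_unorm[e e0 hB].
have [d d0 hd] := h x e Ax e0.
by apply/nbhs_unorm; exists d => // y xy Ay; apply: hB; exact: hd.
Qed.

Lemma unif_continuous_unorm {E F} (A : set E) (f : E -> F) :
  unif_continuous (f : subspace A -> F) <->
  forall e : R, 0 < e -> exists2 d : R, 0 < d & forall x y, A x -> A y ->
    unorm (x - y) < d -> unorm (f x - f y) < e.
Proof.
have entP (G : ultraNormedModType K) (B : set (G * G)) : entourage B <->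
    exists2 e : R, 0 < e & forall x y, unorm (x - y) < e -> B (x, y).
  rewrite -entourage_ballE; split=> [[e /= e0 h]|[e e0 h]].
    by exists e => // x y xy; apply: h; rewrite /= unorm_ball.
  by exists e => // -[x y] /=; rewrite unorm_ball; exact: h.
split=> h.
  move=> e e0; have /h : entourage [set p : F * F | unorm (p.1 - p.2) < e].
    by apply/entP; exists e.
  move=> [B /entP[d d0 hd] hB]; exists d => // x y Ax Ay xy.
  by apply: (hB (x, y)); right; do !split => //; exact: hd.
move=> B /entP[e e0 hB]; have [d d0 hd] := h e e0.
exists [set p : E * E | unorm (p.1 - p.2) < d].
  by apply/entP; exists d.
move=> [x y] /= [->|[Ax [Ay xy]]]; apply: hB; last exact: hd.
by rewrite subrr unorm0.
Qed.

(** Boundedness and uniform continuity are given on open bounded sets only; the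
    sublevel sets of the norm in an open domain are contained in such sets. *)
Lemma bounded_unif_ucb {E F} (D D' : set E) (f : E -> F) :
  open D' -> D' `<=` D -> bounded_unif D f -> ucb D' f.
Proof.
move=> oD' D'D h r.
pose A := D' `&` [set x | unorm x < `|r| + 1].
have rr x : unorm x <= r -> unorm x < `|r| + 1.
  by move=> xr; rewrite ltr_pwDr// (le_trans xr)// ler_norm.
have oA : open A.
  apply/open_unorm => x [D'x xr].
  have /open_unorm/(_ _ D'x)[e e0 he] := oD'.
  exists (Num.min e (`|r| + 1)); first by rewrite lt_min e0/= ltr_wpDl.
  move=> y; rewrite lt_min => /andP[/he D'y xy]; split => //=.
  by rewrite -[y](subKr x); exact: unormB_lt.
have [[b hb] /unif_continuous_unorm hu] : nbounded (f @` A) /\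
    unif_continuous (f : subspace A -> F).
  apply: h => //; first by move=> x [/D'D].
  by exists (`|r| + 1) => x [_ /ltW].
split; first by exists b => x D'x /rr xr; apply: hb; exists x.
by move=> e /hu[d d0 hd]; exists d => // x y Dx Dy /rr xr /rr yr; exact: hd.
Qed.

Lemma ucb_bounded_unif {E F} (D : set E) (f : E -> F) :
  ucb D f -> bounded_unif D f.
Proof.
move=> h A oA AD [r hr]; have [[b hb] hu] := h r; split.
  by exists b => _ [x Ax <-]; apply: hb; [exact: AD|exact: hr].
apply/unif_continuous_unorm => e /hu[d d0 hd]; exists d => // x y Ax Ay.
by apply: hd; [exact: AD|exact: AD|exact: hr|exact: hr].
Qed.

Lemma ucb_within_continuous {E F} (D : set E) (f : E -> F) :
  ucb D f -> {within D, continuous f}.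
Proof.
move=> h; apply/within_continuous_unorm => x e Dx e0.
have [_ /(_ e e0)[d d0 hd]] := h (unorm x + 1).
exists (Num.min d 1) => [|y Dy]; first by rewrite lt_min d0 ltr01.
rewrite lt_min => /andP[xy xy1]; apply: hd => //; first by rewrite lerDl.
rewrite -[y](subKr x); apply: unormB_le; first by rewrite lerDl.
by rewrite (le_trans (ltW xy1))// lerDr unorm_ge0.
Qed.

End bridge.

(** * Iterated difference quotients of maps of class C_b *)

(** A point z = (x; v_1, ..., v_k; t_1, ..., t_k) of phi_space, an increment
    w = (x'; v'_1, ..., v'_k; 0, ..., 0) and a scalar s. *)
Notation dq_space K X k := (phi_space X k * phi_space X k * line K)%type.

Section sources.
Context {R : realType} {K : valuedFieldType R}.
Implicit Types X Y E F : ultraNormedModType K.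

Lemma ucb_add {E F} (S : set E) (f g : E -> F) :
  ucb S f -> ucb S g -> ucb S (fun x => f x + g x).
Proof.
move=> uf ug; have ua : ucb setT (fun u : F * F => u.1 + u.2).
  by apply: ucb_lin; exact: bounded_linear_add.
exact: (ucb_comp (T := setT) (fun _ _ => I) (ucb_pair uf ug) ua).
Qed.

Lemma ucb_shift {E} (S : set (E * E * line K)%type) :
  ucb S (fun z : E * E * line K => z.1.1 + (z.2 : K) *: z.1.2).
Proof.
apply: ucb_add; first by apply: ucb_lin; exact: bounded_linear_fst2.
by apply: ucb_scale; apply: ucb_lin => //; exact: bounded_linear_fst_snd.
Qed.

Lemma open_ucb_preim {E F} (h : E -> F) (A : set F) :
  ucb setT h -> open A -> open (h @^-1` A).
Proof.
move=> /ucb_within_continuous/within_continuous_unorm hh /open_unorm oA.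
apply/open_unorm => x /oA[e e0 he]; have [d d0 hd] := hh x e I e0.
by exists d => // y xy; apply: he; exact: hd.
Qed.

Unset Implicit Arguments.
Fixpoint iquo {X Y} (f : X -> Y) (k : nat) : ups_space X k -> Y :=
  match k return ups_space X k -> Y with
  | 0 => f
  | k'.+1 => quo (iquo f k')
  end.

Fixpoint iquo_dom {X} (S : set X) (k : nat) : set (ups_space X k) :=
  match k return set (ups_space X k) with
  | 0 => S
  | k'.+1 => quo_dom setT (iquo_dom S k')
  end.

Set Implicit Arguments.

Lemma iquo_dom_sub {X} (S : set X) k : iquo_dom S k `<=` ups_dom S k.
Proof.
elim: k => [//|k IH] z [h1 _ h2 _].
by split; exact: IH.
Qed.

Lemma is_ups_iquo {X Y} (D : set X) (f : X -> Y) k (F : ups_space X k -> Y) :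
  is_ups D f k F -> forall z, iquo_dom D k z -> F z = iquo f k z.
Proof.
elim: k F => [|k IH] F /= [_].
  by move=> Ff z Dz; apply: Ff; rewrite inE.
move=> [G hG FG] [[x v] t] hz; have := hz => -[h1 _ h2 h3].
rewrite FG//; last exact: (iquo_dom_sub (k := k.+1) hz).
by rewrite /quo/= !(IH G).
Qed.

Lemma open_ups_dom {X} (D : set X) k : open D -> open (ups_dom D k).
Proof.
move=> oD; elim: k => [//|k IH].
apply: (@openI _ ((fun z : ups_space X k * ups_space X k * line K => z.1.1)
  @^-1` ups_dom D k) ((fun z : ups_space X k * ups_space X k * line K =>
  z.1.1 + (z.2 : K) *: z.1.2) @^-1` ups_dom D k)); apply: open_ucb_preim => //.
  by apply: ucb_lin; exact: bounded_linear_fst2.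
exact: ucb_shift.
Qed.

(** In the bracket scale all directions are allowed at every order, so that the
    iterated quotients of f are by definition those in [smooth]. *)
Lemma smooth_bracket {X Y} m (S : set X) (f : X -> Y) :
  (forall k, (k <= m)%N -> ucb (iquo_dom S k) (iquo f k)) ->
  smooth Bracket m setT setT S f.
Proof.
move=> uf; suff h j k : (k + j <= m)%N ->
    smooth Bracket j setT setT (iquo_dom S k) (iquo f k) by exact: (h m 0%N).
elim: j k => [|j IH] k kj; first by split => //; apply: uf; rewrite addn0 in kj.
split; first by apply: uf; rewrite (leq_trans _ kj)// leq_addr.
split => //; apply: (@smooth_sub _ _ _ _ _ _ _ _ _ setT (iquo_dom S k.+1))=> //.
by apply: IH; rewrite addSnnS.
Qed.

Unset Implicit Arguments.
(** The increment of a point of phi_space that moves its base point by h. *)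
Definition emb {X} (k : nat) (h : X) : phi_space X k := phi_shift h k (0 : phi_space X k).

Set Implicit Arguments.

Lemma phi_shiftE {X} (h : X) k (z : phi_space X k) :
  phi_shift h k z = z + emb k h.
Proof.
rewrite /emb; elim: k z => [|k IH] z /=; first by rewrite add0r.
case: z => -[z v] t /=; rewrite IH.
by congr (_, _, _); rewrite /= ?addr0.
Qed.

Lemma bounded_linear_emb {X} k : bounded_linear (emb k : X -> phi_space X k).
Proof.
rewrite /emb; elim: k => [|k [hl [c c0 hc]]].
  by split=> [a x y|]; [rewrite /= !add0r|exists 1 => // x; rewrite mul1r /= add0r].
split=> [a x y|].
  by rewrite /= hl; congr (_, _, _); rewrite /= scaler0 addr0.
exists c => // x; rewrite !unorm_pair_le/= hc !unorm0.
by rewrite mulr_ge0 ?unorm_ge0.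
Qed.

Unset Implicit Arguments.
(** Increments of the base point and of the vectors, at fixed scalars. *)
Fixpoint phi_dir {X} (k : nat) : set (phi_space X k) :=
  match k return set (phi_space X k) with
  | 0 => setT
  | k'.+1 => prodset (prodset (phi_dir k') setT) (scalar_dir Plain)
  end.

Set Implicit Arguments.

Lemma subm_phi_dir {X} k : subm (phi_dir k : set (phi_space X k)).
Proof.
elim: k => [//|k [h0 hD]]; split; first by do !split.
move=> a x y hx hy; case: hx hy => [[h1 _] h3] [[h1' _] h3'].
split; first by split => //; exact: hD.
by move=> sP; rewrite /= h3// h3'// scaler0 addr0.
Qed.

Lemma phi_dir_emb {X} k (h : X) : phi_dir k (emb k h).
Proof. by rewrite /emb; elim: k => [//|k IH]; do !split. Qed.

Unset Implicit Arguments.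
Fixpoint phi_nz {X} (k : nat) : set (phi_space X k) :=
  match k return set (phi_space X k) with
  | 0 => setT
  | k'.+1 => [set z : phi_space X k' * X * line K |
      phi_nz k' z.1.1 /\ (z.2 : K) != 0]
  end.

Set Implicit Arguments.

Lemma phi_nz_dir {X} k (z w : phi_space X k) (s : K) :
  phi_dir k w -> phi_nz k z -> phi_nz k (z + s *: w).
Proof.
elim: k z w => [//|k IH] z w [[hw _] h0] [hz z0].
split; first exact: IH.
by rewrite /= h0// scaler0 addr0.
Qed.

Lemma phi_nz_shift {X} k (z : phi_space X k) h :
  phi_nz k z -> phi_nz k (phi_shift h k z).
Proof.
by move=> hz; rewrite phi_shiftE -[emb k h]scale1r; apply: phi_nz_dir => //;
  exact: phi_dir_emb.
Qed.

Unset Implicit Arguments.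
Definition dq_pred {X} k (z : dq_space K X k.+1) : dq_space K X k :=
  (z.1.1.1.1, z.1.2.1.1, z.2).

(** (x; x', v_1, ..., v_k; s, t_1, ..., t_k): the argument of Phi^(k+1) that
    accounts for the increment s x' of the base point. *)
Fixpoint dq_base {X} (k : nat) : dq_space K X k -> phi_space X k.+1 :=
  match k return dq_space K X k -> phi_space X k.+1 with
  | 0 => id
  | k'.+1 => fun z => (dq_base k' (dq_pred k' z), z.1.1.1.2, z.1.1.2)
  end.

(** The quotient of Phi^k f in v_i, for the direction v'_i and the scalar s, is
    the value of Phi^k f at the base point moved by t_i v_i, with v'_i and t_i s
    in place of v_i and t_i.  Here i is the last index, and the preceding
    components already carry their increments. *)
Definition dq_head {X} k (z : dq_space K X k.+1) : phi_space X k.+1 :=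
  (z.1.1.1.1 + (z.2 : K) *: z.1.2.1.1 + emb k ((z.1.1.2 : K) *: z.1.1.1.2),
   z.1.2.1.2, (z.1.1.2 : K) *: z.2).

(** The arguments of Phi^k that account for the increments of v_1, ..., v_k. *)
Fixpoint dq_incr {X} (k : nat) : seq (dq_space K X k -> phi_space X k) :=
  match k return seq (dq_space K X k -> phi_space X k) with
  | 0 => [::]
  | k'.+1 => dq_head k' ::
      [seq (fun z : dq_space K X k'.+1 =>
          (psi (dq_pred k' z), z.1.1.1.2, z.1.1.2) : phi_space X k'.+1)
        | psi <- dq_incr k']
  end.

Set Implicit Arguments.

Lemma dq_base_shift {X} k (h : X) (z : dq_space K X k) :
  dq_base k (phi_shift h k z.1.1, z.1.2, z.2) = phi_shift h k.+1 (dq_base k z).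
Proof.
elim: k z => [|k IH] z; first by case: z => -[].
by congr (_, _, _); exact: (IH (dq_pred k z)).
Qed.

Fixpoint Forall_fun {T : Type} (P : T -> Prop) (l : seq T) : Prop :=
  if l is x :: l' then P x /\ Forall_fun P l' else True.

Lemma Forall_fun_map {T U : Type} (P : T -> Prop) (Q : U -> Prop) (g : T -> U) l :
  (forall x, P x -> Q (g x)) -> Forall_fun P l -> Forall_fun Q (map g l).
Proof. by move=> PQ; elim: l => [//|x l IH] /= [/PQ Px /IH]. Qed.

Lemma dq_incr_shift {X} k (h : X) : Forall_fun (fun psi =>
  forall z : dq_space K X k,
  psi (phi_shift h k z.1.1, z.1.2, z.2) = phi_shift h k (psi z)) (dq_incr k).
Proof.
elim: k => [//|k IH] /=; split; last first.
  apply: Forall_fun_map IH => psi hpsi z /=; congr (_, _, _).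
  by rewrite -hpsi.
move=> z; rewrite /dq_head/=; congr (_, _, _).
rewrite !phi_shiftE -!addrA; congr (_ + _).
by rewrite addrCA; congr (_ + _); rewrite addrC.
Qed.

Lemma quo_exchange (V : lmodType K) (s t : K) (a b c d e : V) :
  s^-1 *: (t^-1 *: (a - c) - t^-1 *: (d - e)) =
  (t * s)^-1 *: (a - b) + t^-1 *: (s^-1 *: (b - d) - s^-1 *: (c - e)).
Proof.
rewrite -!scalerBr scalerA -invfM mulrC scalerA -invfM -scalerDr.
congr (_ *: _); rewrite !opprB !addrA subrK.
by rewrite addrAC [RHS]addrAC; congr (_ + _); rewrite addrAC.
Qed.

(** The quotient of Phi^k f in the directions (x, v) is a sum of values of
    Phi^(k+1) f and Phi^k f, an identity valid for every f.  By induction on k: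
    Phi^(k+1) f is a difference of Phi^k f between two base points, divided by
    t, and the arguments in the formula for Phi^k commute with shifts of the
    base point. *)
Lemma quo_Phi {X Y} (f : X -> Y) k (z : dq_space K X k) :
  phi_dir k z.1.2 -> phi_nz k z.1.1 -> (z.2 : K) != 0 ->
  quo (Phi f k) z =
  Phi f k.+1 (dq_base k z) + \sum_(psi <- dq_incr k) Phi f k (psi z).
Proof.
elim: k z => [|k IH] z.
  by case: z => -[x u] s _ _ s0; rewrite big_nil addr0 /quo.
case: z => -[[[z v] t] [[w u] c]] s /= [[/= hw _] /= c0] [/= hz t0] s0.
rewrite {c}c0//.
have IHa := IH (phi_shift ((t : K) *: v) k z, w, s) hw (phi_nz_shift _ hz) s0.
have {IH}IHb := IH (z, w, s) hw hz s0.
rewrite big_cons big_map /= /dq_pred/=.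
rewrite addrCA.
set h := (t : K) *: v in IHa *.
have -> : (t : K)^-1 *: (Phi f k.+1 (phi_shift h k.+1 (dq_base k (z, w, s))) -
    Phi f k.+1 (dq_base k (z, w, s)))
  + \sum_(psi <- dq_incr k) ((t : K)^-1 *: (Phi f k (phi_shift h k (psi (z, w, s))) -
     Phi f k (psi (z, w, s)))) =
  (t : K)^-1 *: (quo (Phi f k) (phi_shift h k z, w, s) - quo (Phi f k) (z, w, s)).
  rewrite IHa IHb -scaler_sumr -scalerDr; congr (_ *: _).
  rewrite opprD addrACA -(dq_base_shift h (z, w, s)); congr (_ + _).
  rewrite -sumrB.
  elim: (dq_incr k) (dq_incr_shift k h) => [|psi l IHl] /=; first by rewrite !big_nil.
  by case=> hpsi /IHl IHl'; rewrite !big_cons IHl' -(hpsi (z, w, s)).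
rewrite /quo /= scaler0 addr0.
rewrite phi_shiftE.
set A := Phi f k (z + _ + emb k ((t : K) *: (v + _))).
rewrite (_ : phi_shift _ k (z + (s : K) *: w + emb k h) =
    z + (s : K) *: w + emb k ((t : K) *: (v + (s : K) *: u))); last first.
  rewrite phi_shiftE -addrA -(bounded_linearD (bounded_linear_emb k)) /h scalerDr.
  by rewrite scalerA.
rewrite -/A !phi_shiftE.
rewrite [z + emb k h + _]addrAC.
set B := Phi f k (z + _ + emb k h); set C := Phi f k (z + _).
set D := Phi f k (z + emb k h); set E := Phi f k z.
exact: quo_exchange.
Qed.

End sources.

(** * Maps of class C_b are smooth on balls *)

Section plain_source.
Context {R : realType} {K : valuedFieldType R} {X Y : ultraNormedModType K}.
Variables (c : X) (rho : R).
Implicit Types (f : X -> Y) (D : set X).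

Definition uball : set X := [set x | unorm (x - c) < rho].

Unset Implicit Arguments.
(** On a ball the domain of Phi^k f reduces to the conditions |t_i v_i| < rho,
    because a ball around zero is an additive subgroup; all scalars are taken
    to be nonzero here. *)
Fixpoint phi_ball (k : nat) : set (phi_space X k) :=
  match k return set (phi_space X k) with
  | 0 => uball
  | k'.+1 => [set z : phi_space X k' * X * line K |
      [/\ phi_ball k' z.1.1, unorm ((z.2 : K) *: z.1.2) < rho
        & (z.2 : K) != 0]]
  end.

Set Implicit Arguments.

Lemma phi_ball_shift k (z : phi_space X k) h :
  phi_ball k z -> unorm h < rho -> phi_ball k (phi_shift h k z).
Proof.
move=> hz hh; elim: k z hz => [|k IH] z /=.
  by rewrite /uball/= addrAC => hz; exact: unormD_lt.
by case=> h1 h2 h3; split => //; exact: IH.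
Qed.

Lemma phi_ball_nz k : phi_ball k `<=` phi_nz k.
Proof. by elim: k => [//|k IH] z [h1 h2 h3]; split => //; exact: IH. Qed.

Lemma phi_ball_def D k : uball `<=` D -> phi_ball k `<=` Phi_def D k.
Proof.
move=> UD; elim: k => [//|k IH] z [h1 h2 h3]; split => //; apply: IH => //.
exact: phi_ball_shift.
Qed.

Lemma phi_ball_end k z : phi_ball k z -> uball (phi_end k z).
Proof.
elim: k z => [//|k IH] z [h1 h2 h3].
by rewrite /uball/= addrAC; apply: unormD_lt => //; exact: IH.
Qed.

Lemma phi_ball_dom k : phi_ball k `<=` phi_dom uball k.
Proof.
elim: k => [//|k IH] z hz; have [h1 h2 h3] := hz.
split; first exact: IH.
exact: (phi_ball_end hz).
Qed.

Lemma phi_dom_sub D D' k : D `<=` D' -> phi_dom D k `<=` phi_dom D' k.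
Proof.
move=> DD; elim: k => [//|k IH] z [h1 h2]; split; first exact: IH.
exact: DD.
Qed.

Lemma ucb_phi_end k : ucb setT (@phi_end R K X k).
Proof.
elim: k => [|k IH] /=; first by apply: ucb_lin; exact: bounded_linear_id.
apply: ucb_add.
  apply: (@ucb_comp _ _ _ _ _ _ setT (fun z : phi_space X k.+1 => z.1.1)
    (phi_end k)) => //.
  by apply: ucb_lin; exact: bounded_linear_fst2.
apply: ucb_scale; apply: ucb_lin; first exact: bounded_linear_snd.
exact: bounded_linear_fst_snd.
Qed.

Lemma open_uball : open uball.
Proof.
apply/open_unorm => x xc; exists rho.
  exact: le_lt_trans (unorm_ge0 _) xc.
by move=> y xy; rewrite /uball/=; apply: (unorm_trans_lt (y := x)) => //; rewrite unormBC.
Qed.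

Lemma open_phi_dom D k : open D -> open (phi_dom D k).
Proof.
move=> oD; elim: k => [//|k IH].
apply: (@openI _ ((fun z : phi_space X k.+1 => z.1.1) @^-1` phi_dom D k)
  (phi_end k.+1 @^-1` D)); apply: open_ucb_preim => //.
  by apply: ucb_lin; exact: bounded_linear_fst2.
exact: ucb_phi_end.
Qed.

Lemma bounded_linear_dq_pred k : bounded_linear (@dq_pred R K X k).
Proof.
apply: bounded_linear_pair => //; apply: bounded_linear_pair.
  exact: (bounded_linear_comp bounded_linear_fst2 bounded_linear_fst2).
exact: (bounded_linear_comp bounded_linear_fst_snd bounded_linear_fst2).
Qed.

Lemma bounded_linear_dq_v k :
  bounded_linear (fun z : dq_space K X k.+1 => z.1.1.1.2).
Proof. exact: (bounded_linear_comp bounded_linear_fst2 bounded_linear_fst_snd). Qed.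

Lemma bounded_linear_dq_t k :
  bounded_linear (fun z : dq_space K X k.+1 => z.1.1.2).
Proof. exact: (bounded_linear_comp bounded_linear_fst2 bounded_linear_snd). Qed.

Lemma dq_pred_dirs k (z : dq_space K X k.+1) :
  dirs Plain (phi_dir k.+1) z -> dirs Plain (phi_dir k) (dq_pred k z).
Proof. by case=> -[[[h1 _] _] [[h2 _] _]] h3; do !split. Qed.

Lemma dq_pred_dom k (z : dq_space K X k.+1) :
  quo_dom (phi_dir k.+1) (phi_ball k.+1) z ->
  quo_dom (phi_dir k) (phi_ball k) (dq_pred k z).
Proof. by case=> -[h1 _ _] [[h2 _] _] [h3 _ _] h4; split. Qed.

Lemma bounded_linear_dq_base k : bounded_linear (@dq_base R K X k).
Proof.
elim: k => [|k IH]; first exact: bounded_linear_id.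
apply: bounded_linear_pair; last exact: bounded_linear_dq_t.
apply: bounded_linear_pair; last exact: bounded_linear_dq_v.
exact: (bounded_linear_comp (bounded_linear_dq_pred k) IH).
Qed.

Lemma dq_base_dirs k (z : dq_space K X k) :
  dirs Plain (phi_dir k) z -> phi_dir k.+1 (dq_base k z).
Proof.
elim: k z => [|k IH] z hz; first by case: hz.
split; last by case: hz => -[[_ h] _] _.
by split => //; apply/IH/dq_pred_dirs.
Qed.

Lemma dq_base_dom k (z : dq_space K X k) :
  quo_dom (phi_dir k) (phi_ball k) z -> phi_ball k.+1 (dq_base k z).
Proof.
elim: k z => [|k IH] z hz.
  case: hz => h1 _ h2 h3; split => //.
  suff -> : (z.2 : K) *: z.1.2 = (z.1.1 + (z.2 : K) *: z.1.2 - c) - (z.1.1 - c).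
    exact: unormB_lt.
  by rewrite opprB addrA subrK addrAC subrr add0r.
split; first by apply: (IH (dq_pred k z)); exact: dq_pred_dom.
  by case: hz => -[].
by case: hz => -[].
Qed.

Lemma dq_head_dom k (z : dq_space K X k.+1) :
  quo_dom (phi_dir k.+1) (phi_ball k.+1) z -> phi_ball k.+1 (dq_head k z).
Proof.
case=> -[h1 h2 h3] [_ hc] [h4 h5 h6] h7; split => //=.
- by rewrite -phi_shiftE; apply: phi_ball_shift.
- move: h5; rewrite /= hc// scaler0 addr0 scalerDr => h5.
  rewrite (_ : _ *: _ = (z.1.1.2 : K) *: z.1.1.1.2 +
    (z.1.1.2 : K) *: ((z.2 : K) *: z.1.2.1.2) - (z.1.1.2 : K) *: z.1.1.1.2).
    exact: unormB_lt.
  by rewrite addrAC subrr add0r scalerA.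
- by rewrite [X in X != 0](_ : _ = (z.1.1.2 : K) * (z.2 : K))// mulf_neq0.
Qed.

Lemma smooth_dq_head j k :
  smooth Plain j (phi_dir k.+1) (dirs Plain (phi_dir k.+1))
    (quo_dom (phi_dir k.+1) (phi_ball k.+1)) (@dq_head R K X k).
Proof.
have hk := @subm_phi_dir R K X k.
apply: smooth_pair; first apply: smooth_pair.
- apply: smooth_add => //; first apply: smooth_add => //.
  + apply: smooth_lin; last by move=> z [[[[]]]].
    exact: (bounded_linear_comp bounded_linear_fst2 bounded_linear_fst2).
  + apply: smooth_scale => //.
    * by move=> z [_ [[]]].
    * exact: smooth_lin.
    * apply: smooth_lin; last by move=> z [[_ [[]]]].
      exact: (bounded_linear_comp bounded_linear_fst_snd bounded_linear_fst2).
  + apply: (smooth_comp (LF := setT) (T := setT)) => //.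
      apply: smooth_scale => //; apply: smooth_lin => //.
        exact: bounded_linear_dq_t.
      exact: bounded_linear_dq_v.
    apply: smooth_lin; first exact: bounded_linear_emb.
    by move=> x _; exact: phi_dir_emb.
- apply: smooth_lin => //.
  exact: (bounded_linear_comp bounded_linear_fst_snd bounded_linear_fst_snd).
apply: smooth_param => //.
  by apply: ucb_scale; apply: ucb_lin => //; exact: bounded_linear_dq_t.
move=> z v t _ [[[_ v1] _] v2] _ /=.
by rewrite v1// v2// !scaler0 !addr0.
Qed.

Lemma dq_incr_smooth j k : Forall_fun (fun psi =>
    (forall z, quo_dom (phi_dir k) (phi_ball k) z -> phi_ball k (psi z)) /\
    smooth Plain j (phi_dir k) (dirs Plain (phi_dir k))
      (quo_dom (phi_dir k) (phi_ball k)) psi) (@dq_incr R K X k).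
Proof.
elim: k => [//|k IH]; split.
  by split; [exact: dq_head_dom|exact: smooth_dq_head].
apply: Forall_fun_map IH => psi [hd hs]; split.
  move=> z hz; have := hd _ (dq_pred_dom hz).
  by case: hz => -[h1 h2 h3] _ _ _; split.
apply: smooth_pair; first apply: smooth_pair.
- apply: smooth_precomp hs.
  + exact: bounded_linear_dq_pred.
  + exact: dq_pred_dirs.
  + exact: dq_pred_dom.
- by apply: smooth_lin => //; exact: bounded_linear_dq_v.
- apply: smooth_lin; first exact: bounded_linear_dq_t.
  by move=> z [[[]]].
Qed.

(** Induction on the order, simultaneously for all Phi^k f: by [quo_Phi], a
    quotient of Phi^k f is a sum of composites of Phi^k f and Phi^(k+1) f with
    polynomial maps. *)
Lemma smooth_plain m f :
  (forall k, (k <= m)%N -> ucb (phi_ball k) (Phi f k)) ->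
  smooth Plain m setT setT uball f.
Proof.
move=> uf; suff h j k : (k + j <= m)%N ->
    smooth Plain j setT (phi_dir k) (phi_ball k) (Phi f k) by exact: (h m 0%N).
elim: j k => [|j IH] k kj; first by split => //; apply: uf; rewrite addn0 in kj.
split; first by apply: uf; rewrite (leq_trans _ kj)// leq_addr.
split => //.
apply: (@smooth_eq _ _ _ _ _ _ _ _ _ (fun z =>
  Phi f k.+1 (dq_base k z) + \sum_(psi <- dq_incr k) Phi f k (psi z))).
  by move=> z [h1 h2 h3 h4]; rewrite quo_Phi//; exact: phi_ball_nz.
apply: smooth_add => //.
  apply: (smooth_comp (LF := phi_dir k.+1) (T := phi_ball k.+1)).
  - exact: dq_base_dom.
  - by apply: smooth_lin; [exact: bounded_linear_dq_base|exact: dq_base_dirs].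
  - by apply: IH; rewrite addSnnS.
have IHk : smooth Plain j setT (phi_dir k) (phi_ball k) (Phi f k).
  by apply: IH; rewrite (leq_trans _ kj)// leq_add2l.
elim: (dq_incr k) (dq_incr_smooth j k) => [_|psi l IHl [[hd hs] /IHl hl]].
  by apply: smooth_eq (smooth_cst _ _ _ _ (0 : Y) I) => // z _; rewrite big_nil.
apply: smooth_eq (smooth_add _ (smooth_comp hd hs IHk) hl) => // z _.
by rewrite big_cons.
Qed.

Lemma smooth_of_C_b s n m D f :
  uball `<=` D -> C_b s n D f -> below m n ->
  smooth s m setT setT uball f.
Proof.
move=> UD Cf mn.
have Cfk k : (k <= m)%N -> exists F, is_S_b s D f k F.
  by move=> km; apply: Cf; case: n mn => //= n mn; exact: leq_trans mn.
case: s {Cf} Cfk => Cfk.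
  apply: smooth_plain => k /Cfk[F [[_ FE] uF]].
  apply: (@ucb_eq _ _ _ _ _ F).
    by move=> z hz; rewrite FE// inE; exact: phi_ball_def hz.
  apply: ucb_sub (bounded_unif_ucb (open_phi_dom k open_uball) _ uF).
    exact: phi_ball_dom.
  exact: phi_dom_sub.
apply: smooth_bracket => k /Cfk[F [hF uF]].
have UD' : iquo_dom uball k `<=` iquo_dom D k.
  elim: k {F hF uF} => [//|k IH] z [h1 h2 h3 h4].
  by split => //; exact: IH.
apply: (@ucb_eq _ _ _ _ _ F).
  by move=> z /UD' hz; exact: (is_ups_iquo hF).
apply: ucb_sub (bounded_unif_ucb (open_ups_dom k open_uball) _ uF).
  exact: iquo_dom_sub.
elim: k {F hF uF UD'} => [//|k IH] z [h1 h2].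
by split; exact: IH.
Qed.

End plain_source.

(** * Density of nonzero scalars and extension by completeness *)

Section density.
Context {R : realType} {K : valuedFieldType R}.
Implicit Types X Y E : ultraNormedModType K.

Lemma small_scalar (e : R) : 0 < e -> exists2 t : K, t != 0 & absv t < e.
Proof.
move=> e0.
have [x x0 x1] : exists2 x : K, x != 0 & 1 < absv x.
  have [x [x0 x1]] := @absv_nontrivial R K.
  case: (ltrgtP (absv x) 1) x1 => // [x1 _|x1 _]; last by exists x.
  exists x^-1; first by rewrite invr_eq0.
  by rewrite absvV invf_gt1// lt_neqAle absv_ge0 andbT eq_sym;
    apply: contra x0 => /eqP/absv_eq0/eqP.
pose a := absv x - 1; have a0 : 0 < a by rewrite subr_gt0.
have bern k : 1 + k%:R * a <= absv (x ^+ k).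
  elim: k => [|k IH]; first by rewrite mul0r addr0 expr0 absv1.
  have xE : absv x = 1 + a by rewrite /a addrCA subrr addr0.
  rewrite exprS absvM xE.
  apply: (@le_trans _ _ ((1 + a) * (1 + k%:R * a))).
    rewrite -natr1 [(k%:R + 1) * a]mulrDl mul1r addrA.
    rewrite [X in _ <= X]mulrDl mul1r lerD2l ler_peMr ?(ltW a0)//.
    by rewrite lerDl mulr_ge0// ltW.
  by rewrite ler_wpM2l// addr_ge0 ?ler01// ltW.
pose k := Num.bound (e^-1 / a).
have ek : e^-1 < absv (x ^+ k).
  apply: lt_le_trans (bern k); rewrite ltr_wpDl// -ltr_pdivrMr//.
  by rewrite archi_boundP// ltW// divr_gt0// invr_gt0.
exists (x ^+ k)^-1; first by rewrite invr_eq0 expf_neq0.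
by rewrite absvV -[e]invrK ltf_pV2// posrE ?invr_gt0// (lt_trans _ ek)// invr_gt0.
Qed.

Lemma near_scalar (t : line K) (e : R) : 0 < e ->
  exists2 t' : line K, (t' : K) != 0 & unorm (t - t') < e.
Proof.
move=> e0; have [t0|t0] := eqVneq (t : K) 0.
  have [t' t'0 t'e] := small_scalar e0; exists t' => //.
  by rewrite (_ : t = 0)// sub0r unormN.
by exists t => //; rewrite subrr unorm0.
Qed.

Definition udense {E} (S : set E) : Prop :=
  forall x (e : R), 0 < e -> exists2 y, S y & unorm (x - y) < e.

Lemma udense_phi_nz {X} k : udense (@phi_nz R K X k).
Proof.
elim: k => [|k IH] x e e0; first by exists x; rewrite // subrr unorm0.
case: x => -[x v] t; have [x' hx' xx'] := IH x e e0.
have [t' t'0 tt'] := near_scalar t e0.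
exists (x', v, t') => //.
by rewrite !unorm_pair_lt/= xx' tt' subrr unorm0 e0.
Qed.

(** Besides x and t, also x + tv must be moved into a dense set; this determines
    the change of v, which is small if x + tv moves by much less than |t|. *)
Lemma udense_iquo_dom {X} k : udense (@iquo_dom R K X setT k).
Proof.
elim: k => [|k IH] x e e0; first by exists x; rewrite // subrr unorm0.
case: x => -[x v] t; have [x' hx' xx'] := IH x e e0.
have [t' t'0 tt'] := near_scalar t e0.
have a0 : 0 < absv (t' : K).
  by rewrite lt_neqAle absv_ge0 andbT eq_sym; apply: contra t'0 => /eqP/absv_eq0/eqP.
have [y hy xy] := IH (x' + (t' : K) *: v) _ (mulr_gt0 e0 a0).
exists (x', (t' : K)^-1 *: (y - x'), t').
  split => //=; rewrite scalerA mulfV// scale1r addrCA subrr addr0//.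
rewrite !unorm_pair_lt/= xx' tt' andbT/=.
rewrite (_ : v - _ = (t' : K)^-1 *: (x' + (t' : K) *: v - y)).
  by rewrite unormZ absvV mulrC ltr_pdivrMr.
rewrite -[v in LHS]scale1r -(mulVf t'0) -scalerA -scalerBr; congr (_ *: _).
by rewrite opprB addrA; congr (_ - _); exact: addrC.
Qed.

Lemma ucb_eq_dense {E Y} (S : set E) (f g : E -> Y) :
  udense S -> ucb setT f -> ucb setT g -> (forall x, S x -> f x = g x) ->
  forall x, f x = g x.
Proof.
move=> dS /ucb_within_continuous/within_continuous_unorm hf.
move=> /ucb_within_continuous/within_continuous_unorm hg fg x.
apply/eqP; rewrite -subr_eq0; apply/eqP; apply: unorm_small => e e0.
have [d d0 hd] := hf x e I e0; have [d' d'0 hd'] := hg x e I e0.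
have [|y Sy] := dS x (Num.min d d'); first by rewrite lt_min d0.
rewrite lt_min => /andP[xy xy'].
apply: (unorm_trans_lt (y := f y)); first exact: hd.
by rewrite fg// unormBC; exact: hd'.
Qed.

Lemma ucb_extend {E Y} (S : set E) (f : E -> Y) :
  banach Y -> udense S -> ucb S f ->
  exists F : E -> Y, [/\ forall x, S x -> F x = f x, ucb setT F &
    forall x (e : R), 0 < e -> exists2 y, S y &
      unorm (x - y) < e /\ unorm (F x - f y) < e].
Proof.
move=> bY dS uf.
have lim x : exists l : Y, forall e : R, 0 < e -> exists2 d : R, 0 < d &
    forall y, S y -> unorm (x - y) < d -> unorm (l - f y) < e.
  pose G := f @ within S (nbhs x).
  have PG : ProperFilter G.
    apply: fmap_proper_filter; apply: Build_ProperFilter_ex => A.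
    move=> /nbhs_unorm[d d0 hd]; have [y Sy xy] := dS x d d0.
    by exists y; apply: hd.
  have cG : cauchy G.
    apply: cauchy_exP => e e0.
    have [_ /(_ e e0)[d d0 hd]] := uf (unorm x + 1).
    have d1 : 0 < Num.min d 1 by rewrite lt_min d0/=.
    have nx y : unorm (x - y) < Num.min d 1 -> unorm y <= unorm x + 1.
      rewrite lt_min => /andP[_ xy]; rewrite -[y](subKr x).
      apply: unormB_le; first by rewrite lerDl.
      by rewrite (le_trans (ltW xy))// lerDr unorm_ge0.
    have [x0 Sx0 xx0] := dS x _ d1; exists (f x0).
    apply/nbhs_unorm; exists (Num.min d 1) => // y xy Sy /=.
    rewrite unorm_ball; apply: hd => //; [exact: nx|exact: nx|].
    apply: (unorm_trans_lt (y := x)).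
      by rewrite unormBC; apply: lt_le_trans xx0 _; rewrite ge_min lexx.
    by apply: lt_le_trans xy _; rewrite ge_min lexx.
  have [l Gl] := bY G PG cG; exists l => e e0.
  have /Gl : nbhs l [set z | unorm (l - z) < e] by apply/nbhs_unorm; exists e.
  by move=> /nbhs_unorm[d d0 hd]; exists d => // y Sy /hd; exact.
have [F hF] := choice lim.
have near x (e : R) : 0 < e -> exists2 y, S y &
    unorm (x - y) < e /\ unorm (F x - f y) < e.
  move=> e0; have [d d0 hd] := hF x e e0.
  have [|y Sy] := dS x (Num.min d e); first by rewrite lt_min d0.
  by rewrite lt_min => /andP[xy xy']; exists y => //; split => //; exact: hd.
exists F; split => //.
  move=> x Sx; apply/eqP; rewrite -subr_eq0; apply/eqP; apply: unorm_small => e e0.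
  by have [d d0 hd] := hF x e e0; apply: hd => //; rewrite subrr unorm0.
move=> r; have [[b hb] hu] := uf (Num.max r 1).
have nr x y : unorm x <= r -> unorm (x - y) < 1 -> unorm y <= Num.max r 1.
  move=> xr xy; rewrite -[y](subKr x); apply: unormB_le.
    by rewrite le_max xr.
  by rewrite le_max (ltW xy) orbT.
split.
  exists (Num.max b 1) => x _ xr; have [y Sy [xy xy']] := near x 1 ltr01.
  rewrite -(subrK (f y) (F x)); apply: unormD_le; rewrite le_max.
    by rewrite (ltW xy') orbT.
  by rewrite hb//; exact: nr xr xy.
move=> e e0; have [d d0 hd] := hu e e0; exists (Num.min d 1).
  by rewrite lt_min d0/=.
move=> x y _ _ xr yr; rewrite lt_min => /andP[xy _].
pose e' := Num.min e (Num.min d 1).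
have e'0 : 0 < e' by rewrite !lt_min e0 d0/=.
have [e'e e'd e'1] : [/\ e' <= e, e' <= d & e' <= 1].
  by rewrite /e' !ge_min !lexx !orbT.
have [x' Sx' [xx' fx']] := near x e' e'0.
have [y' Sy' [yy' fy']] := near y e' e'0.
apply: (unorm_trans_lt (y := f x')); first exact: lt_le_trans fx' _.
apply: (unorm_trans_lt (y := f y')); last first.
  by rewrite unormBC; exact: lt_le_trans fy' _.
apply: hd => //; [apply: nr xr _|apply: nr yr _|]; try exact: lt_le_trans e'1.
apply: (unorm_trans_lt (y := x)); first by rewrite unormBC; exact: lt_le_trans e'd.
by apply: (unorm_trans_lt (y := y)) => //; exact: lt_le_trans e'd.
Qed.

End density.

(** * Smooth families of maps *)

Section target.
Context {R : realType} {K : valuedFieldType R}.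
Context {X P Y : ultraNormedModType K}.

Unset Implicit Arguments.
Definition dquo (s : scale) (f : X -> Y) (k : nat) : S_space s X k -> Y :=
  match s return S_space s X k -> Y with
  | Plain => Phi f k
  | Bracket => iquo f k
  end.

Definition dquo_dom (s : scale) (k : nat) : set (S_space s X k) :=
  match s return set (S_space s X k) with
  | Plain => phi_nz k
  | Bracket => iquo_dom setT k
  end.
Set Implicit Arguments.

Lemma smooth_le {E F : ultraNormedModType K} s j m (LF : set F) (L S : set E)
    (f : E -> F) : (j <= m)%N -> smooth s m LF L S f -> smooth s j LF L S f.
Proof.
move=> jm; rewrite -(subnK jm); elim: (m - j)%N => [//|i IH] h.
by apply: IH; apply: smoothW.
Qed.

(** The iterated quotients in x of a function of (x, y) depend smoothly on their
    arguments, with y as a parameter: directions have no y-component. *)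
Lemma smooth_iquo_param m (T : X * P -> Y) j k :
  smooth Bracket m setT setT setT T -> (k + j <= m)%N ->
  smooth Bracket j setT (prodset setT [set 0]) (prodset (iquo_dom setT k) setT)
    (fun u : ups_space X k * P => iquo (fun x => T (x, u.2)) k u.1).
Proof.
move=> sT; elim: k j => [|k IH] j kj.
  apply: smooth_eq (smooth_sub _ _ (smooth_le kj sT)) => //.
  by case.
have kj' : (k + j.+1 <= m)%N by rewrite addnS -addSn.
have [_ [_ sq]] := IH _ kj'.
pose l (u : ups_space X k.+1 * P) : (ups_space X k * P) * (ups_space X k * P) * line K :=
  ((u.1.1.1, u.2), (u.1.1.2, 0), u.1.2).
apply: smooth_eq (smooth_precomp (l := l) _ _ _ sq).
- by move=> u _; rewrite /quo/= scaler0 addr0.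
- apply: bounded_linear_pair; last first.
    exact: (bounded_linear_comp bounded_linear_fst bounded_linear_snd).
  apply: bounded_linear_pair; apply: bounded_linear_pair => //.
    exact: (bounded_linear_comp bounded_linear_fst bounded_linear_fst2).
  exact: (bounded_linear_comp bounded_linear_fst bounded_linear_fst_snd).
- by move=> u [_ h]; do !split.
- by move=> u [[h1 _ h2 h3] _]; do !split.
Qed.

Lemma smooth_Phi_param m (T : X * P -> Y) j k :
  smooth Plain m setT setT setT T -> (k + j <= m)%N ->
  smooth Plain j setT (prodset (phi_dir k) [set 0]) (prodset (phi_nz k) setT)
    (fun u : phi_space X k * P => Phi (fun x => T (x, u.2)) k u.1).
Proof.
move=> sT; elim: k j => [|k IH] j kj.
  apply: smooth_eq (smooth_sub _ _ (smooth_le kj sT)) => //.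
  by case.
have kj' : (k + j.+1 <= m)%N by rewrite addnS -addSn.
have [_ [_ sq]] := IH _ kj'.
pose l (u : phi_space X k.+1 * P) : (phi_space X k * P) * (phi_space X k * P) * line K :=
  ((u.1.1.1, u.2), (emb k u.1.1.2, 0), u.1.2).
have lE (u : phi_space X k.+1 * P) :
    u.1.1.1 + (u.1.2 : K) *: emb k u.1.1.2 = phi_shift ((u.1.2 : K) *: u.1.1.2) k u.1.1.1.
  by rewrite phi_shiftE (bounded_linearZ (bounded_linear_emb k)).
apply: smooth_eq (smooth_precomp (l := l) _ _ _ sq).
- by move=> u _; rewrite /quo/= scaler0 addr0 lE.
- apply: bounded_linear_pair; last first.
    exact: (bounded_linear_comp bounded_linear_fst bounded_linear_snd).
  apply: bounded_linear_pair; apply: bounded_linear_pair => //.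
    exact: (bounded_linear_comp bounded_linear_fst bounded_linear_fst2).
  apply: (bounded_linear_comp _ (bounded_linear_emb k)).
  exact: (bounded_linear_comp bounded_linear_fst bounded_linear_fst_snd).
- by move=> u [[[h1 _] h2] h]; do !split => //; exact: phi_dir_emb.
- move=> u [[h1 h2] _]; split => //.
  + by split => //; exact: phi_dir_emb.
  + by split => //; rewrite /= lE; exact: phi_nz_shift.
Qed.

Lemma ucb_dquo_param s m (T : X * P -> Y) k :
  smooth s m setT setT setT T -> (k <= m)%N ->
  ucb (prodset (dquo_dom s k) setT)
    (fun u : S_space s X k * P => dquo s (fun x => T (x, u.2)) k u.1).
Proof.
case: s => sT km; rewrite -[k in (k <= _)%N]addn0 in km.
  exact: smooth_ucb (smooth_Phi_param sT km).
exact: smooth_ucb (smooth_iquo_param sT km).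
Qed.

Lemma udense_dquo_dom s k : udense (dquo_dom s k).
Proof. by case: s; [exact: udense_phi_nz|exact: udense_iquo_dom]. Qed.

(** The recursion that defines Upsilon^k holds for the continuous extensions
    because it holds on a dense set, after multiplication by t. *)
Lemma is_ups_extension (f : X -> Y) m :
  (forall k, (k <= m)%N -> exists F : ups_space X k -> Y, ucb setT F /\
     forall z, iquo_dom setT k z -> F z = iquo f k z) ->
  forall k (F : ups_space X k -> Y), (k <= m)%N -> ucb setT F ->
    (forall z, iquo_dom setT k z -> F z = iquo f k z) -> is_ups setT f k F.
Proof.
move=> ext; elim=> [|k IH] F km uF FE.
  split; first exact: ucb_within_continuous.
  by move=> x _; exact: FE.
split; first by apply: ucb_within_continuous; exact: ucb_sub uF.
have [G [uG GE]] := ext k (ltnW km).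
exists G; first exact: IH (ltnW km) uG GE.
move=> x v t _ t0.
pose g1 (z : ups_space X k.+1) : Y := (z.2 : K) *: F z + G z.1.1.
pose g2 (z : ups_space X k.+1) : Y := G (z.1.1 + (z.2 : K) *: z.1.2).
have g12 : g1 (x, v, t) = g2 (x, v, t).
  apply: (ucb_eq_dense (@udense_iquo_dom R K X k.+1)).
  - apply: ucb_add.
      by apply: ucb_scale => //; apply: ucb_lin; exact: bounded_linear_snd.
    apply: (@ucb_comp _ _ _ _ _ _ setT (fun z : ups_space X k.+1 => z.1.1) G) => //.
    by apply: ucb_lin; exact: bounded_linear_fst2.
  - apply: (@ucb_comp _ _ _ _ _ _ setT
      (fun z : ups_space X k.+1 => z.1.1 + (z.2 : K) *: z.1.2) G) => //.
    exact: ucb_shift.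
  - move=> z hz; rewrite /g1 /g2 FE//; case: hz => h1 _ h2 h3.
    by rewrite !GE//= /quo scalerA mulfV// scale1r subrK.
rewrite -[G (x + _)]/(g2 (x, v, t)) -g12 /g1/= addrK scalerA mulVf//.
by rewrite scale1r.
Qed.

Lemma dquo_extension s (f : X -> Y) m :
  (forall k, (k <= m)%N -> exists F : S_space s X k -> Y, ucb setT F /\
     forall z, dquo_dom s k z -> F z = dquo s f k z) ->
  forall k (F : S_space s X k -> Y), (k <= m)%N -> ucb setT F ->
    (forall z, dquo_dom s k z -> F z = dquo s f k z) -> is_S_b s setT f k F.
Proof.
case: s => ext k F km uF FE; (split; last by apply: ucb_bounded_unif; exact: ucb_sub uF).
  split; first by apply: ucb_within_continuous; exact: ucb_sub uF.
  move=> z; rewrite inE => hz; apply: FE.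
  elim: k {F km uF} z hz => [//|k IH] z [h1 h2 _]; split => //.
  exact: IH.
exact: is_ups_extension ext _ _ km uF FE.
Qed.

Lemma dquo_zero s k (f : X -> Y) z : (forall x, f x = 0) -> dquo s f k z = 0.
Proof.
move=> f0; case: s z; rewrite /dquo; elim: k => [|k IH] z /=; rewrite ?f0//.
  by rewrite !IH subrr scaler0.
by rewrite /quo !IH subrr scaler0.
Qed.

(** The difference quotients of the members of a family T(., y) are uniformly
    continuous in all variables including y, and vanish at y = 0; hence they
    are uniformly small on bounded sets for small y. *)
Lemma C_b_family s n (T : X * P -> Y) :
  banach Y -> (forall m, below m n -> smooth s m setT setT setT T) ->
  (forall x, T (x, 0) = 0) ->
  (forall y, C_b s n setT (fun x => T (x, y))) /\
  forall k (r e : R), below k n -> 0 < e -> exists2 d : R, 0 < d &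
    forall y, unorm y < d -> exists2 F, is_S_b s setT (fun x => T (x, y)) k F &
      forall z, unorm z <= r -> unorm (F z) < e.
Proof.
move=> bY sT T0.
have ucbT k : below k n -> ucb (prodset (dquo_dom s k) setT)
    (fun u : S_space s X k * P => dquo s (fun x => T (x, u.2)) k u.1).
  by move=> kn; exact: ucb_dquo_param (sT _ kn) _.
have ucby y k : below k n -> ucb (dquo_dom s k) (dquo s (fun x => T (x, y)) k).
  move=> kn; apply: (ucb_comp (f := fun z : S_space s X k => (z, y)) _ _ (ucbT k kn)).
    by move=> z hz.
  by apply: ucb_pair; [exact: ucb_lin|exact: ucb_cst].
have ext y k : below k n -> exists F : S_space s X k -> Y, [/\
    forall z, dquo_dom s k z -> F z = dquo s (fun x => T (x, y)) k z, ucb setT F &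
    forall x (e : R), 0 < e -> exists2 z, dquo_dom s k z & unorm (x - z) < e /\
      unorm (F x - dquo s (fun x => T (x, y)) k z) < e].
  by move=> kn; apply: ucb_extend => //; [exact: udense_dquo_dom|exact: ucby].
have isS y k F : below k n -> ucb setT F ->
    (forall z, dquo_dom s k z -> F z = dquo s (fun x => T (x, y)) k z) ->
    is_S_b s setT (fun x => T (x, y)) k F.
  move=> kn uF FE; apply: (dquo_extension (m := k)) => // k' kk'.
  have [|G [GE uG _]] := ext y k'; last by exists G.
  by case: (n) kn => //= m; exact: leq_trans.
split.
  by move=> y k kn; have [F [FE uF _]] := ext y k kn; exists F; exact: isS.
move=> k r e kn e0; have [_ /(_ e e0)[d d0 hd]] := ucbT k kn (Num.max r 1).
exists (Num.min d 1); first by rewrite lt_min d0/=.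
move=> y; rewrite lt_min => /andP[yd y1].
have [F [FE uF Fnear]] := ext y k kn; exists F; first exact: isS.
move=> z zr; have [|z' hz' [zz' Fz']] := Fnear z (Num.min e 1).
  by rewrite lt_min e0/=.
rewrite -(subrK (dquo s (fun x => T (x, y)) k z') (F z)).
move: zz' Fz'; rewrite !lt_min => /andP[_ zz'] /andP[Fz' _].
apply: unormD_lt => //.
have z'r : unorm z' <= Num.max r 1.
  rewrite -[z'](subKr z); apply: unormB_le; rewrite le_max ?zr//.
  by rewrite (ltW zz') orbT.
have := hd (z', y) (z', 0) (conj hz' I) (conj hz' I).
rewrite /= (@dquo_zero s k (fun x => T (x, 0)) z' T0) subr0; apply.
- by rewrite unorm_pair_le/= z'r le_max (ltW y1) orbT.
- by rewrite unorm_pair_le/= z'r unorm0 le_max ler01 orbT.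
- by rewrite unorm_pair_lt/= subrr unorm0 d0 subr0.
Qed.

End target.

(** * Operations on maps of class C_b and their neighborhoods of zero *)

Section C_b_theory.
Context {R : realType} {K : valuedFieldType R}.
Context {X P Y : ultraNormedModType K}.
Implicit Types (D : set X) (f g : X -> Y) (s : scale).

Lemma ups_dom_sub D D' k : D `<=` D' -> ups_dom D k `<=` ups_dom D' k.
Proof. by move=> DD; elim: k => [//|k IH] z [h1 h2]; split; exact: IH. Qed.

Lemma S_dom_sub s D D' k : D `<=` D' -> S_dom s D k `<=` S_dom s D' k.
Proof. by case: s; [exact: phi_dom_sub|exact: ups_dom_sub]. Qed.

Lemma Phi_def_sub D D' k : D `<=` D' -> Phi_def D k `<=` Phi_def D' k.
Proof.
by move=> DD; elim: k => [//|k IH] z [h1 h2 h3]; split => //; exact: IH.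
Qed.

Lemma is_S_b_sub s D D' f k F :
  D `<=` D' -> is_S_b s D' f k F -> is_S_b s D f k F.
Proof.
move=> DD [hF bF]; split; last first.
  by move=> A oA /subset_trans/(_ (S_dom_sub DD)) AD; exact: bF.
case: s F hF {bF} => F.
  move=> [cF FE]; split.
    exact: continuous_subspaceW (S_dom_sub (s := Plain) DD) cF.
  move=> z; rewrite inE => hz; apply: FE; rewrite inE.
  exact: Phi_def_sub DD _ hz.
rewrite /is_S; elim: k F => [|k IH] F [cF FE].
  split; first exact: continuous_subspaceW DD cF.
  by move=> x; rewrite inE => /DD Dx; apply: FE; rewrite inE.
split; first exact: continuous_subspaceW (ups_dom_sub (k := k.+1) DD) cF.
have [G hG FG] := FE; exists G; first exact: IH.
by move=> x v t /(ups_dom_sub (k := k.+1) DD); exact: FG.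
Qed.

Lemma is_S_b_eq s D f g k F :
  (forall x, D x -> f x = g x) -> is_S_b s D f k F -> is_S_b s D g k F.
Proof.
move=> fg [hF bF]; split => //.
case: s F hF {bF} => F.
  move=> [cF FE]; split => // z hz; rewrite FE//; move: hz; rewrite inE => {cF FE F}.
  elim: k z => [|k IH] z /=; first exact: fg.
  by case=> h1 h2 h3; rewrite !IH.
rewrite /is_S; elim: k F => [|k IH] F [cF FE].
  by split => // x xD; rewrite FE//; apply: fg; rewrite inE in xD.
by split => //; have [G hG FG] := FE; exists G => //; exact: IH.
Qed.

Lemma within_continuousD {E : ultraNormedModType K} (D : set E) (f g : E -> Y) :
  {within D, continuous f} -> {within D, continuous g} ->
  {within D, continuous (fun x => f x + g x)}.
Proof.
move=> /within_continuous_unorm hf /within_continuous_unorm hg.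
apply/within_continuous_unorm => x e Dx e0.
have [d d0 hd] := hf x e Dx e0; have [d' d'0 hd'] := hg x e Dx e0.
exists (Num.min d d'); first by rewrite lt_min d0.
move=> y Dy; rewrite lt_min => /andP[xy xy'].
by rewrite opprD addrACA; apply: unormD_lt; [exact: hd|exact: hd'].
Qed.

Lemma bounded_unifD {E : ultraNormedModType K} (D : set E) (f g : E -> Y) :
  bounded_unif D f -> bounded_unif D g -> bounded_unif D (fun x => f x + g x).
Proof.
move=> hf hg A oA AD bA.
have [[b hb] /unif_continuous_unorm hf'] := hf A oA AD bA.
have [[c hc] /unif_continuous_unorm hg'] := hg A oA AD bA.
split.
  exists (Num.max b c) => _ [x Ax <-]; apply: unormD_le; rewrite le_max.
    by rewrite hb//; exists x.
  by rewrite hc ?orbT//; exists x.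
apply/unif_continuous_unorm => e e0.
have [d d0 hd] := hf' e e0; have [d' d'0 hd'] := hg' e e0.
exists (Num.min d d'); first by rewrite lt_min d0.
move=> x y Ax Ay; rewrite lt_min => /andP[xy xy'].
by rewrite opprD addrACA; apply: unormD_lt; [exact: hd|exact: hd'].
Qed.

Lemma is_S_b_add s D f g k F G : is_S_b s D f k F -> is_S_b s D g k G ->
  is_S_b s D (fun x => f x + g x) k (fun z => F z + G z).
Proof.
move=> [hF bF] [hG bG]; split; last exact: bounded_unifD.
case: s F G hF hG {bF bG} => F G; rewrite /is_S.
  move=> [cF FE] [cG GE]; split; first exact: within_continuousD.
  move=> z hz; rewrite /= FE// GE//; move: hz; rewrite inE => {cF FE F cG GE G}.
  elim: k z => [//|k IH] z [h1 h2 h3] /=.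
  by rewrite -!IH// -scalerDr opprD addrACA.
elim: k F G => [|k IH] F G [cF FE] [cG GE].
  split; first exact: within_continuousD.
  by move=> x xD; rewrite /= FE// GE.
split; first exact: within_continuousD.
have [F' hF' FF] := FE; have [G' hG' GG] := GE.
exists (fun z => F' z + G' z); first exact: IH.
by move=> x v t h t0; rewrite FF// GG// -scalerDr opprD addrACA.
Qed.

Lemma C_b_sub s n D D' f : D `<=` D' -> C_b s n D' f -> C_b s n D f.
Proof. by move=> DD hf k /hf[F hF]; exists F; exact: is_S_b_sub hF. Qed.

Lemma C_b_eq s n D f g :
  (forall x, D x -> f x = g x) -> C_b s n D f -> C_b s n D g.
Proof. by move=> fg hf k /hf[F hF]; exists F; exact: is_S_b_eq hF. Qed.

Lemma C_b_add s n D f g :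
  C_b s n D f -> C_b s n D g -> C_b s n D (fun x => f x + g x).
Proof.
move=> hf hg k kn; have [F hF] := hf k kn; have [G hG] := hg k kn.
by exists (fun z => F z + G z); exact: is_S_b_add.
Qed.

Lemma C_b_order s n n' D f : order_le n n' -> C_b s n' D f -> C_b s n D f.
Proof.
move=> nn hf k kn; apply: hf; case: n nn kn => [m|] /=; last by move=> /eqP ->.
by case: n' => //= m' mm km; exact: leq_trans mm.
Qed.

Lemma S_args_bounded s (A : set X) y0 k : nbounded A ->
  exists r : R, forall z, S_args s A [set x - y0 | x in A] k z -> unorm z <= r.
Proof.
move=> [b hb]; pose r := Num.max 1 (Num.max b (unorm y0)); exists r.
have r1 : 1 <= r by rewrite le_max lexx.
have Ar x : A x -> unorm x <= r by move=> /hb h; rewrite !le_max h orbT.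
have Qr x : [set x - y0 | x in A] x -> unorm x <= r.
  by move=> [y /Ar Ay <-]; apply: unormB_le => //; rewrite !le_max lexx !orbT.
case: s => /=.
  elim: k => [//|k IH] z [h1 h2 h3]; rewrite !unorm_pair_le IH// Qr//=.
  exact: le_trans r1.
have : forall B : set X, (forall x, B x -> unorm x <= r) ->
    forall z, ups_args B [set x - y0 | x in A] k z -> unorm z <= r.
  elim: k => [//|k IH] B hB z [h1 h2 h3]; rewrite !unorm_pair_le (IH _ hB)//.
  by rewrite (IH _ Qr)//=; exact: le_trans r1.
by apply.
Qed.

Lemma finite_radius (T : finType) (Q : T -> R -> Prop) :
  (forall i (d d' : R), d' <= d -> Q i d -> Q i d') ->
  (forall i, exists2 d : R, 0 < d & Q i d) ->
  exists2 d : R, 0 < d & forall i, Q i d.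
Proof.
move=> Qm h; have /choice[d hd] : forall i, exists d : R, 0 < d /\ Q i d.
  by move=> i; have [d d0 hd] := h i; exists d.
exists (\big[Num.min/1]_i d i) => [|i].
  by elim/big_ind: _ => // [x y x0 y0|i _]; [rewrite lt_min x0|case: (hd i)].
apply: Qm (proj2 (hd i)); rewrite (bigD1 i)//=.
by rewrite ge_min lexx.
Qed.

(** A smooth family with T(., 0) = 0 enters every neighborhood of zero as its
    parameter tends to zero. *)
Lemma C_b_nbhs0_family s n (T : X * P -> Y) D N :
  banach Y -> (forall m, below m n -> smooth s m setT setT setT T) ->
  (forall x, T (x, 0) = 0) -> C_b_nbhs0 s n D N ->
  exists2 d : R, 0 < d & forall y, unorm y < d -> forall g,
    (forall x, D x -> T (x, y) = g x) -> N g.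
Proof.
move=> bY sT T0 [q [m [V [A [y0 [hA hN]]]]]].
have [Cy small] := C_b_family bY sT T0.
have base a : exists2 d : R, 0 < d & forall y, unorm y < d -> forall g,
    (forall x, D x -> T (x, y) = g x) ->
    C_b_base s n D (m a) (V a) (A a) (y0 a) g.
  have [mn [oV V0] [_ bA AD] Ay0] := hA a.
  have /open_unorm/(_ _ V0)[e e0 he] := oV.
  have [d d0 hd] : exists2 d : R, 0 < d & forall k : 'I_(m a).+1, forall y,
      unorm y < d -> exists2 F, is_S_b s setT (fun x => T (x, y)) k F &
      S_args s (A a) [set x - y0 a | x in A a] k `<=` F @^-1` V a.
    apply: finite_radius => [k d d' dd h y yd|k].
      by apply: h; exact: lt_le_trans dd.
    have [r hr] := @S_args_bounded s _ (y0 a) k bA.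
    have kn : below k n.
      by case: (n) mn => //= n0; apply: leq_trans; rewrite -ltnS.
    have [d d0 hd] := small k r e kn e0; exists d => // y /hd[F hF Fe].
    exists F => // z /hr/Fe zr; apply: he.
    by rewrite sub0r unormN.
  exists d => // y yd g Tg; split.
    by apply: C_b_eq Tg _; exact: C_b_sub (@subsetT _ D) (Cy y).
  move=> k km; rewrite -ltnS in km.
  have [F hF FV] := hd (Ordinal km) y yd; exists F.
    by apply: is_S_b_eq Tg _; exact: is_S_b_sub (@subsetT _ D) hF.
  by move=> z [_ /FV].
have [d d0 hd] : exists2 d : R, 0 < d & forall a y, unorm y < d -> forall g,
    (forall x, D x -> T (x, y) = g x) ->
    C_b_base s n D (m a) (V a) (A a) (y0 a) g.
  apply: finite_radius => [a d d' dd h y yd|//].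
  by apply: h; exact: lt_le_trans dd.
exists d => // y yd g Tg; apply: hN; split => [|a _]; last exact: hd Tg.
by apply: C_b_eq Tg _; exact: C_b_sub (@subsetT _ D) (Cy y).
Qed.

End C_b_theory.

(** * One-parameter subgroups in characteristic p *)

(** gy 1 iterated p times is gy p = gy 0. *)
Lemma one_parameter_iter {R : realType} {K : valuedFieldType R} {p : nat}
    (charK : p \in [pchar K]) {X : ultraNormedModType K} {M : ptopologicalType}
    {Lambda : finType} {U : Lambda -> set M} {phi : Lambda -> M -> X} {s n}
    {gy : K -> M -> M} :
  one_parameter_subgroup U phi s n gy -> forall q, iter p (gy 1) q = q.
Proof.
move=> [_ g0 gD] q.
have -> k : iter k (gy 1) q = gy k%:R q.
  by elim: k => [|k IH]; [rewrite g0|rewrite iterS IH -natr1 addrC gD].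
by rewrite (pcharf0 charK) g0.
Qed.

(** The relation is sum_k (k - 1) u_k = 0.  With b_k = a_(k+1) - a_k, its terms
    are increments of the p-periodic sequence (k - 1) b_k - a_(k+1). *)
Lemma second_difference_dependent {R : realType} {K : valuedFieldType R}
    {p : nat} (charK : p \in [pchar K]) {X : ultraNormedModType K}
    {M : Type} (iota : M -> X) (g ginv : M -> M) :
  cancel g ginv -> cancel ginv g -> (forall q, iter p g q = q) ->
  let h := (iota \o g) \- iota in
  ~ lin_indep (fun k : 'I_p => k != 1%N :> nat)
      (fun k => (h \- (h \o ginv)) \o iter k g : M -> X).
Proof.
move=> gK gK' gp h li.
have pp : prime p := pcharf_prime charK.
have p0 : (0 < p)%N := prime_gt0 pp.
pose c (k : 'I_p) : K := (k : nat)%:R - 1.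
suff : c (Ordinal p0) = 0 by rewrite /c sub0r => /eqP; rewrite oppr_eq0 oner_eq0.
apply: li => //.
apply/funext => q.
pose a (k : nat) := iota (iter k g (ginv q)).
have aE k : ((h \- (h \o ginv)) \o iter k g) q = (a k.+2 - a k.+1) - (a k.+1 - a k).
  have ik : iter k g q = iter k.+1 g (ginv q) by rewrite iterSr gK'.
  by rewrite /= /h/= /GRing.sub_fun/= !ik /= gK.
have sE : (\sum_(i < p | i != 1%N :> nat)
      c i *: ((h \- (h \o ginv)) \o iter i g : M -> X)) q =
    \sum_(i < p) c i *: (((h \- (h \o ginv)) \o iter i g) q).
  rewrite fct_sumE big_mkcond; apply: eq_bigr => i _.
  by case: eqP => //= i1; rewrite /c i1 subrr scale0r.
rewrite sE; under eq_bigr => i _ do rewrite aE.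
pose w (k : nat) : X := (k%:R - 1 : K) *: (a k.+1 - a k) - a k.+1.
have -> : \sum_(i < p) c i *: (a i.+2 - a i.+1 - (a i.+1 - a i)) =
    \sum_(i < p) (w i.+1 - w i).
  apply: eq_bigr => i _; rewrite /w /c.
  have -> : i.+1%:R - 1 = (i%:R - 1) + 1 :> K by rewrite -natr1 addrAC.
  move: (i%:R - 1 : K) => ci; rewrite scalerBr scalerDl scale1r.
  set x := _ *: (a i.+2 - _); set y := _ *: (a i.+1 - _).
  rewrite opprB addrA; apply/eqP; rewrite -subr_eq0; apply/eqP.
  rewrite -[x + _ - a i.+2]addrA [_ - _ - a i.+2]addrAC subrr sub0r.
  by rewrite subrK subrr.
rewrite -(big_mkord xpredT (fun i => w i.+1 - w i)) telescope_sumr//.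
rewrite /w (pcharf0 charK) /a iterSr gp iterS !iter0.
have -> : iter p g (ginv q) = ginv q by exact: gp.
by rewrite /= subrr.
Qed.

(** * Dilations of a coordinate ball *)

Section dilation.
Context {R : realType} {K : valuedFieldType R} {X : ultraNormedModType K}.
Context {M : ptopologicalType} {Lambda : finType}.
Variables (U : Lambda -> set M) (phi : Lambda -> M -> X).
Variables (s : scale) (n' : option nat).
Hypothesis atlasM : is_atlas U phi s n'.

Let psi i : X -> M := pinv (U i) (phi i).

Let psiK i q : U i q -> psi i (phi i q) = q.
Proof.
have [inj _ _] := atlas_homeo atlasM i.
by move=> Uq; rewrite /psi pinvKV// inE.
Qed.

Let phi_inj i q q' : U i q -> U i q' -> phi i q = phi i q' -> q = q'.
Proof. by move=> Uq Uq' e; rewrite -(psiK Uq) e psiK. Qed.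

Lemma chart_continuous i q (e : R) : U i q -> 0 < e ->
  nbhs q [set q' | U i q' /\ unorm (phi i q - phi i q') < e].
Proof.
move=> Uq e0.
have [_ /subspace_continuousP h _] := atlas_homeo atlasM i.
have : nbhs (phi i q) [set x | unorm (phi i q - x) < e].
  by apply/nbhs_unorm; exists e.
move=> /(h q Uq); rewrite /fmap/= /within/= => hq.
have : nbhs q (U i) by apply: open_nbhs_nbhs; split => //; exact: atlas_open atlasM i.
by move=> hU; apply: filterS (filterI hU hq) => q' [Uq' /(_ Uq')].
Qed.

(** The inverse of a chart is continuous on an open set. *)
Lemma chart_open i q (V : set M) : U i q -> nbhs q V ->
  exists2 e : R, 0 < e & forall x, unorm (phi i q - x) < e ->
    exists q', [/\ U i q', V q' & phi i q' = x].
Proof.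
move=> Uq hV.
have [_ _ /subspace_continuousP h] := atlas_homeo atlasM i.
have iUq : (phi i @` U i) (phi i q) by exists q.
have hV' : nbhs (pinv (U i) (phi i) (phi i q)) V by rewrite -/(psi i) psiK.
have := h _ iUq V hV'; rewrite /fmap/= /within/= => /nbhs_unorm[e e0 he].
have [e' e'0 he'] := (proj1 (open_unorm _) (atlas_image atlasM i)) _ iUq.
exists (Num.min e e'); first by rewrite lt_min e0.
move=> x; rewrite lt_min => /andP[/he Vx /he'[q' Uq' q'x]].
exists q'; split => //; rewrite -(psiK Uq') q'x; apply: Vx.
by exists q'.
Qed.

Definition charts_at (m : M) : set M := [set q | forall j, U j m -> U j q].

(** Take a point in the largest possible number of chart domains: the points
    common to these domains lie in no other one. *)
Lemma exists_generic_point :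
  exists m : M, forall q, charts_at m q -> forall j, U j q -> U j m.
Proof.
pose charts q := [pred j | `[< U j q >]].
pose P k := `[< exists q, #|charts q| = k >].
have exP : exists k, P k by exists #|charts point|; apply/asboolP; exists point.
have ubP k : P k -> (k <= #|Lambda|)%N.
  by move=> /asboolP[q <-]; exact: max_card.
have [k /asboolP[m mk] kmax] := ex_maxnP exP ubP.
exists m => q mq j Ujq.
have sub : charts m \subset charts q.
  by apply/fintype.subsetP => l; rewrite !inE; exact: mq.
have eq : #|charts m| = #|charts q|.
  apply/eqP; rewrite eqn_leq subset_leq_card//= mk; apply: kmax.
  by apply/asboolP; exists q.
have := subset_cardP eq sub j; rewrite !inE => e.
by apply/asboolP; rewrite e; apply/asboolP.
Qed.

Lemma nbhs_charts m : nbhs m (charts_at m).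
Proof.
apply: (@filter_forall _ _ (fun j q => U j m -> U j q)) => j.
have [Um|nUm] := pselect (U j m); last by apply: filterE => q.
have : nbhs m (U j) by apply: open_nbhs_nbhs; split => //; exact: atlas_open atlasM j.
by apply: filterS.
Qed.

(** In every chart around m there is a ball rho i all of whose points belong to
    all chart domains around m; in the chart j0 there is moreover a ball of
    radius r whose points lie in all of these balls. *)
Lemma exists_coordinate_ball m j0 : U j0 m ->
  exists (rho : Lambda -> R) (r : R), [/\ forall i, 0 < rho i,
    forall i, U i m -> forall x, unorm (x - phi i m) < rho i ->
      exists q, [/\ U i q, charts_at m q & phi i q = x],
    0 < r &
    forall x, unorm (x - phi j0 m) < r -> exists q, [/\ U j0 q, charts_at m q,
      forall i, U i m -> unorm (phi i q - phi i m) < rho i & phi j0 q = x]].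
Proof.
move=> Um0.
have /choice[rho hrho] : forall i, exists d : R, 0 < d /\ (U i m ->
    forall x, unorm (x - phi i m) < d ->
    exists q, [/\ U i q, charts_at m q & phi i q = x]).
  move=> i; have [Um|nUm] := pselect (U i m); last by exists 1; split.
  have [d d0 hd] := chart_open Um (nbhs_charts m).
  by exists d; split => // _ x; rewrite unormBC; exact: hd.
have hV : nbhs m [set q | charts_at m q /\
    forall i, U i m -> unorm (phi i q - phi i m) < rho i].
  apply: filterI; first exact: nbhs_charts.
  apply: (@filter_forall _ _ (fun i q =>
    U i m -> unorm (phi i q - phi i m) < rho i)) => i.
  have [Um|nUm] := pselect (U i m); last by apply: filterE => q.
  apply: filterS (chart_continuous Um (proj1 (hrho i))) => q [_ h] _.
  by rewrite unormBC.
have [r r0 hr] := chart_open Um0 hV.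
exists rho, r; split=> // [i|i|x]; [exact: (hrho i).1|exact: (hrho i).2|].
by rewrite unormBC => /hr[q [Uq [cq hq] qx]]; exists q.
Qed.

Variables (m : M) (j0 : Lambda).
Hypothesis generic : forall q, charts_at m q -> forall j, U j q -> U j m.
Hypothesis Um0 : U j0 m.

Let W : set M := charts_at m.
Let c : X := phi j0 m.

Variable rho : Lambda -> R.
Hypothesis rho_gt0 : forall i, 0 < rho i.
Hypothesis rhoP : forall i, U i m -> forall x, unorm (x - phi i m) < rho i ->
  exists q, [/\ U i q, W q & phi i q = x].
Variable r : R.
Hypothesis r_gt0 : 0 < r.
Hypothesis rP : forall x, unorm (x - c) < r -> exists q, [/\ U j0 q,
  W q, forall i, U i m -> unorm (phi i q - phi i m) < rho i & phi j0 q = x].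

Let B : set M := [set q | U j0 q /\ unorm (phi j0 q - c) < r].

Let BW q : B q -> W q.
Proof.
case=> U0 /rP[q' [Uq' Wq' _ e]].
by rewrite -(phi_inj Uq' U0 e).
Qed.

Let B_rho q i : B q -> U i m -> unorm (phi i q - phi i m) < rho i.
Proof.
case=> U0 /rP[q' [Uq' _ h e]] Um.
by rewrite -(phi_inj Uq' U0 e); exact: h.
Qed.

Let psiB x : unorm (x - c) < r -> B (psi j0 x) /\ phi j0 (psi j0 x) = x.
Proof.
move=> h; have [q [Uq _ _ e]] := rP h.
by rewrite -e psiK//; split => //; split => //; rewrite e.
Qed.

Let BU q j : B q -> U j q <-> U j m.
Proof. by move=> Bq; split; [apply: generic; exact: BW|exact: (BW Bq)]. Qed.

(** Dilation by 1 + y of the ball B around m, in the coordinates of the chart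
    j0. *)
Definition dilate (y : K) (q : M) : M :=
  if `[< B q >] then psi j0 (c + (1 + y) *: (phi j0 q - c)) else q.

Let dilate_norm (y : K) (x : X) : absv y < 1 -> unorm ((1 + y) *: x) <= unorm x.
Proof.
move=> y1; rewrite unormZ ler_piMl ?unorm_ge0//.
by rewrite (le_trans (absvD _ _))// ge_max absv1 lexx ltW.
Qed.

Lemma dilate_in (y : K) q : absv y < 1 -> B q ->
  B (dilate y q) /\ phi j0 (dilate y q) = c + (1 + y) *: (phi j0 q - c).
Proof.
move=> y1 Bq; rewrite /dilate asboolT//; apply: psiB.
rewrite addrAC subrr add0r; apply: le_lt_trans (dilate_norm _ y1) _.
by case: Bq.
Qed.

Lemma dilate_out (y : K) q : ~ B q -> dilate y q = q.
Proof. by move=> Bq; rewrite /dilate asboolF. Qed.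

Lemma dilate_chart (y : K) q j : absv y < 1 -> U j (dilate y q) <-> U j q.
Proof.
move=> y1; have [Bq|Bq] := pselect (B q); last by rewrite dilate_out.
by have [Bdq _] := dilate_in y1 Bq; rewrite !BU.
Qed.

Lemma dilateK (y y' : K) : absv y < 1 -> absv y' < 1 -> (1 + y') * (1 + y) = 1 ->
  cancel (dilate y) (dilate y').
Proof.
move=> y1 y'1 yy q; have [Bq|Bq] := pselect (B q); last by rewrite !dilate_out.
have [Bdq dq] := dilate_in y1 Bq; have [Bddq ddq] := dilate_in y'1 Bdq.
apply: (@phi_inj j0); [by case: Bddq|by case: Bq|].
by rewrite ddq dq (addrAC c) subrr add0r scalerA yy scale1r addrC subrK.
Qed.

Let sigma i : X -> X := phi j0 \o psi i.
Let tau j : X -> X := phi j \o psi j0.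

Let zone i : set (X * line K) :=
  [set u | (uball (phi i m) (rho i) u.1 /\ absv (u.2 : K) < 1) /\
           uball c r (sigma i u.1)].

Let bump i j (u : X * line K) : X :=
  tau j (c + (1 + u.2 : K) *: (sigma i u.1 - c)) - tau j (sigma i u.1).

(** The displacement of g_y in the charts i and j: it is added to the transition
    map.  The set zone i keeps the first variable in the ball rho i, where
    the transition map to the chart j0 is smooth, so that the cutoff takes
    place inside the domain. *)
Definition displacement i j (u : X * line K) : X :=
  if `[< U i m /\ U j m >] then cut (zone i) (bump i j) u else 0.

Lemma displacement0 i j x : displacement i j (x, 0) = 0.
Proof.
rewrite /displacement; case: asboolP => // _; rewrite /cut; case: asboolP => // _.
by rewrite /bump/= addr0 scale1r [c + _]addrC subrK subrr.
Qed.

Lemma displacementE i j (y : K) q : absv y < 1 -> U i q -> U j q ->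
  phi j (dilate y q) = phi j q + displacement i j (phi i q, y).
Proof.
move=> y1 Ui Uj; have [Bq|Bq] := pselect (B q).
  have Uim : U i m by apply/(BU i Bq).
  have Ujm : U j m by apply/(BU j Bq).
  have [U0 qr] := Bq.
  rewrite /displacement asboolT// cut_in; last first.
    split; [split => //=; exact: B_rho|].
    by rewrite /uball/= /sigma/= psiK.
  by rewrite /bump /sigma /tau/= !psiK// addrC subrK /dilate asboolT.
rewrite dilate_out// /displacement; case: asboolP => [[Uim Ujm]|_]; last by rewrite addr0.
rewrite cut_out ?addr0// => -[[/= C1 _]]; rewrite /sigma/= psiK// => hq.
apply: Bq; split => //.
have [q' [Uq' Wq' e]] := rhoP Uim C1.
by rewrite -(phi_inj Uq' Ui e); exact: (Wq' j0).
Qed.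

Lemma uclopen_uball {E : ultraNormedModType K} (a : E) (e : R) : 0 < e ->
  uclopen setT (uball a e).
Proof.
move=> e0 r'; exists e => // x y _ _ _ _ xy xa.
by apply: (unorm_trans_lt (y := x)) => //; rewrite unormBC.
Qed.

Lemma uclopen_trans {E : ultraNormedModType K} (T S S' : set E) :
  S' `<=` S -> uclopen T S -> uclopen S S' -> uclopen T S'.
Proof.
move=> S'S h h' r'; have [d d0 hd] := h r'; have [d' d'0 hd'] := h' r'.
exists (Num.min d d'); first by rewrite lt_min d0.
move=> x y Tx Ty xr yr; rewrite lt_min => /andP[xy xy'] S'x.
have Sx := S'S _ S'x; have Sy := hd x y Tx Ty xr yr xy Sx.
exact: hd' S'x.
Qed.

Let smooth_transition k i j : U i m -> U j m -> below k n' ->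
  smooth s k setT setT (uball (phi i m) (rho i)) (phi j \o psi i).
Proof.
move=> Ui Uj kn; apply: smooth_of_C_b kn; last exact: (atlas_transition atlasM i j).
move=> x /(rhoP Ui)[q [Uq Wq <-]]; exists q => //; split => //.
exact: Wq.
Qed.

(** By the chain rule on the zone, and by the cutoff outside of it. *)
Lemma smooth_displacement k i j : below k n' ->
  smooth s k setT setT setT (displacement i j).
Proof.
move=> kn; have [[Ui Uj]|nU] := pselect (U i m /\ U j m); last first.
  apply: smooth_eq (smooth_cst s k setT setT (0 : X) I) => // u _.
  by rewrite /displacement asboolF.
apply: (@smooth_eq _ _ _ _ _ _ _ _ _ (cut (zone i) (bump i j))).
  by move=> u _; rewrite /displacement asboolT.
have s_sigma : smooth s k setT setT (uball (phi i m) (rho i)) (sigma i).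
  exact: smooth_transition.
have s_tau : smooth s k setT setT (uball c (rho j0)) (tau j).
  exact: smooth_transition.
pose Z1 : set (X * line K) := [set u | uball (phi i m) (rho i) u.1 /\ absv (u.2 : K) < 1].
have cZ1 : uclopen setT Z1.
  apply: uclopenI.
    apply: (@uclopen_preim _ _ _ _ setT _ setT fst) => //; first exact: ucb_lin.
    exact: uclopen_uball.
  apply: (@uclopen_eq _ _ _ _ (snd @^-1` uball (0 : line K) 1)).
    by move=> u _; rewrite /uball/= subr0.
  apply: (@uclopen_preim _ _ _ _ setT _ setT snd) => //; first exact: ucb_lin.
  exact: uclopen_uball.
have s_sigma1 S : S `<=` Z1 -> smooth s k setT setT S (fun u : X * line K => sigma i u.1).
  move=> SZ; apply: smooth_precomp s_sigma => //.
  by move=> u /SZ[].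
have cZ : uclopen setT (zone i).
  apply: (uclopen_trans (S := Z1)) => //; first by move=> u [].
  have uZ : uclopen Z1 ((fun u : X * line K => sigma i u.1) @^-1` uball c r).
    apply: uclopen_preim (uclopen_uball c r_gt0) => //.
    exact: smooth_ucb (s_sigma1 Z1 _).
  apply: uclopen_eq uZ => u Zu; split; last by case.
  by move=> h; split.
apply: smooth_cut => //.
have in_tau q : B q -> uball c (rho j0) (phi j0 q) by move=> Bq; exact: B_rho.
have in_tau' x : uball c r x -> uball c (rho j0) x.
  by move=> /rP[q [Uq _ h <-]]; exact: h.
have zZ : zone i `<=` Z1 by move=> u [].
apply: smooth_add => //.
  apply: (smooth_comp (LF := setT) (T := uball c (rho j0))) s_tau.
    move=> u [[_ y1] h]; apply: in_tau'; rewrite /uball/= addrAC subrr add0r.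
    exact: le_lt_trans (dilate_norm _ y1) h.
  apply: smooth_add => //; first exact: smooth_cst.
  apply: (@smooth_scale _ _ s k _ _ setT setT (zone i)
    (fun u : X * line K => (1 + u.2 : K) : line K) (fun u => sigma i u.1 - c)) => //.
    apply: smooth_add => //; first exact: (smooth_cst _ _ _ _ (1 : line K)).
    exact: smooth_lin.
  apply: smooth_add => //; first exact: s_sigma1.
  exact: smooth_cst.
apply: smooth_opp => //.
apply: (smooth_comp (LF := setT) (T := uball c (rho j0))) s_tau.
  by move=> u [_ h]; exact: in_tau'.
exact: s_sigma1.
Qed.

(** In each chart g_y is x |-> x + displacement, which is continuous on all of
    X.  This also settles the points of the closure of B outside of the chart
    j0. *)
Lemma dilate_continuous (y : K) : absv y < 1 -> continuous (dilate y).
Proof.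
move=> y1 q V hV.
have [j _ Uq] : (\bigcup_i U i) q by rewrite (atlas_cover atlasM).
have Udq : U j (dilate y q) by apply/dilate_chart.
have [e e0 he] := chart_open Udq hV.
have k0 : below 0 n' by case: (n').
have uh : ucb setT (fun x => x + displacement j j (x, y)).
  apply: ucb_add; first by apply: ucb_lin; exact: bounded_linear_id.
  apply: (@ucb_comp _ _ _ _ _ _ setT (fun x => (x, y : line K))) => //.
    by apply: ucb_pair; [apply: ucb_lin; exact: bounded_linear_id|exact: ucb_cst].
  exact: smooth_ucb (smooth_displacement j j k0).
have [d d0 hd] := proj1 (within_continuous_unorm _ _) (ucb_within_continuous uh)
  (phi j q) e I e0.
apply: filterS (chart_continuous Uq d0) => q' [Uq' qq'].
have := hd (phi j q') I qq'; rewrite -!displacementE// => /he[q'' [Uq'' Vq'' e'']].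
rewrite /= -(phi_inj Uq'' _ e'')//.
exact/dilate_chart.
Qed.

Lemma rep_dom_dilate (y : K) i j : absv y < 1 ->
  rep_dom U phi (dilate y) i j = phi i @` (U i `&` U j).
Proof.
move=> y1; rewrite /rep_dom; congr (_ @` _); apply/seteqP.
by split=> q [Ui Uj]; split => //; apply/(dilate_chart q j y1).
Qed.

Lemma rep_dilate (y : K) i j x : absv y < 1 -> (phi i @` (U i `&` U j)) x ->
  rep U phi (dilate y) i j x = rep U phi id i j x + displacement i j (x, y).
Proof.
move=> y1 [q [Ui Uj] <-].
by rewrite /rep/= -!/(psi i) psiK//; exact: displacementE.
Qed.

Lemma inv_scalar (y : K) : absv y < 1 ->
  exists y' : K, [/\ absv y' < 1, (1 + y') * (1 + y) = 1 & (1 + y) * (1 + y') = 1].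
Proof.
move=> y1; have y11 : 1 <= absv (1 + y).
  have := absvD (1 + y) (- y); rewrite addrK absv1 absvN le_max.
  by rewrite [X in _ || X]leNgt y1 orbF.
have y0 : 1 + y != 0.
  by apply: contraTneq y11 => ->; rewrite absv0 -ltNge ltr01.
have e : 1 + ((1 + y)^-1 - 1) = (1 + y)^-1 by rewrite addrC subrK.
exists ((1 + y)^-1 - 1); rewrite e mulVf// mulfV//; split => //.
rewrite (_ : _ - 1 = - y * (1 + y)^-1); last first.
  apply: (mulIf y0); rewrite mulrBl mulVf// mul1r -mulrA mulVf// mulr1.
  by rewrite opprD addrA subrr sub0r.
rewrite absvM absvN absvV (le_lt_trans _ y1)// ler_piMr ?absv_ge0//.
by rewrite invf_le1// (lt_le_trans ltr01).
Qed.

Hypothesis banachX : banach X.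
Variable n : option nat.
Hypothesis le_nn' : order_le n n'.

Let smooth_displacement_n k i j : below k n ->
  smooth s k setT setT setT (displacement i j).
Proof.
move=> kn; apply: smooth_displacement; case: (n) (n') le_nn' kn => [a|] [b|] //=.
by move=> ab ka; exact: leq_trans ab.
Qed.

Lemma C_b_map_dilate (y : K) : absv y < 1 -> C_b_map U phi s n (dilate y).
Proof.
move=> y1 i j; rewrite rep_dom_dilate//.
have [Cd _] := C_b_family banachX (fun k => @smooth_displacement_n k i j)
  (displacement0 i j).
apply: (@C_b_eq _ _ _ _ _ _ _
  (fun x => rep U phi id i j x + displacement i j (x, y))).
  by move=> x hx; rewrite rep_dilate.
apply: C_b_add; last exact: C_b_sub (@subsetT _ _) (Cd y).
exact: C_b_order le_nn' (atlas_transition atlasM i j).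
Qed.

Lemma Diff_dilate (y : K) : absv y < 1 -> Diff U phi s n (dilate y).
Proof.
move=> y1; have [y' [y'1 yy yy']] := inv_scalar y1.
exists (dilate y'); split; do ?[exact: dilateK|exact: dilate_continuous].
by split; exact: C_b_map_dilate.
Qed.

Lemma dilate_near_id (O : set (M -> M)) : Diff_open U phi s n O -> O id ->
  exists2 d : R, 0 < d & forall y : K, absv y < d -> absv y < 1 -> O (dilate y).
Proof.
move=> [_ hO] Oid; have [N [hN NO]] := hO _ Oid.
have near ij : exists2 d : R, 0 < d & forall y : line K, unorm y < d ->
    forall g, (forall x, rep_dom U phi id ij.1 ij.2 x ->
      displacement ij.1 ij.2 (x, y) = g x) -> N ij.1 ij.2 g.
  exact: C_b_nbhs0_family banachX (fun k => @smooth_displacement_n k ij.1 ij.2)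
    (displacement0 ij.1 ij.2) (hN ij.1 ij.2).
have [d d0 hd] : exists2 d : R, 0 < d & forall (ij : Lambda * Lambda) (y : line K),
    unorm y < d -> forall g, (forall x, rep_dom U phi id ij.1 ij.2 x ->
      displacement ij.1 ij.2 (x, y) = g x) -> N ij.1 ij.2 g.
  apply: finite_radius => [ij d d' dd h y yd|//].
  by apply: h; exact: lt_le_trans dd.
exists d => // y yd y1; apply: NO; first exact: Diff_dilate.
move=> i j; split; first by rewrite rep_dom_dilate.
apply: (hd (i, j) y yd) => x hx; rewrite rep_dilate//.
by rewrite [_ + displacement _ _ _]addrC addrK.
Qed.

Lemma iter_dilate (y : K) q k : absv y < 1 -> B q ->
  B (iter k (dilate y) q) /\
  phi j0 (iter k (dilate y) q) = c + (1 + y) ^+ k *: (phi j0 q - c).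
Proof.
move=> y1 Bq; elim: k => [|k [Bk ek]].
  by rewrite expr0 scale1r addrC subrK.
have [Bk' ek'] := dilate_in y1 Bk; split => //.
by rewrite iterS ek' ek (addrAC c) subrr add0r scalerA exprS.
Qed.

(** By Frobenius, g_y^p moves x - c by y^p (x - c). *)
Lemma iter_dilate_neq (p : nat) (charK : p \in [pchar K]) (e : X) (y : K) :
  e != 0 -> absv y < 1 -> y != 0 -> exists q, iter p (dilate y) q <> q.
Proof.
move=> e0 y1 y0.
have ne : 0 < unorm e.
  by rewrite lt_neqAle unorm_ge0 andbT eq_sym; apply: contra e0 => /eqP/unorm_eq0/eqP.
have [t t0 te] := small_scalar (K := K) (divr_gt0 r_gt0 ne).
have vr : unorm ((c + t *: e) - c) < r.
  by rewrite addrAC subrr add0r unormZ -ltr_pdivlMr.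
have [Bq eq] := psiB vr; exists (psi j0 (c + t *: e)) => h.
have [_] := iter_dilate p y1 Bq; rewrite h eq.
rewrite [c + _ - c]addrAC subrr add0r => /addrI /eqP.
have -> : (1 + y) ^+ p = 1 + y ^+ p.
  by rewrite -!(pFrobenius_autE charK) rmorphD rmorph1.
rewrite scalerDl scale1r -[X in X == _]addr0 (inj_eq (addrI _)) eq_sym.
by rewrite !scaler_eq0 expf_eq0 (negPf y0) andbF (negPf t0) (negPf e0).
Qed.

End dilation.

(** * Diffeomorphisms outside of all one-parameter subgroups *)

Lemma c0_neq0 {R : realType} (K : valuedFieldType R) (gamma : Type) (g : gamma) :
  exists e : c0 gamma K, e != 0.
Proof.
pose f (j : gamma) : K^o := if `[< j = g >] then 1 else 0.
have nf : f \in @null_family R gamma K.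
  apply/asboolP => e e0; apply: sub_finite_set (finite_set1 g) => j /=.
  rewrite /f; case: asboolP => // _; rewrite absv0 => h.
  by have := lt_trans e0 h; rewrite ltxx.
exists (C0 nf); apply/eqP => /(congr1 (fun x : c0 gamma K => x g)) /=.
by rewrite /f asboolT// => /eqP; rewrite (negPf (oner_neq0 _)).
Qed.

Unset Implicit Arguments.

Theorem mainTheorem6 (R : realType) (K : valuedFieldType R)
  (p : nat) (charK : p \in [pchar K])
  (gamma : Type) (gamma_neq0 : [set: gamma] !=set0)
  (banachX : banach (c0 gamma K))
  (s : scale) (n n' : option nat) (le_nn' : order_le n n')
  (M : ptopologicalType) (Lambda : finType)
  (U : Lambda -> set M) (phi : Lambda -> M -> c0 gamma K)
  (atlasM : is_atlas U phi s n')
  (bounded_charts : forall j, nbounded (phi j @` U j)) :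
  (forall O, Diff_open U phi s n O -> O id ->
     exists g, [/\ O g, g <> id &
       ~ exists gy, [/\ one_parameter_subgroup U phi s n gy,
                        exists y, gy y <> id & gy 1 = g]]) /\
  (forall iota : M -> c0 gamma K, homeo_onto_image [set: M] iota ->
   forall g ginv : M -> M, Diff U phi s n g ->
     cancel g ginv -> cancel ginv g -> g <> id ->
     let h := (iota \o g) \- iota in
     (* the indices are k = 0, 2, ..., p-1 *)
     lin_indep (fun k : 'I_p => k != 1%N :> nat)
       (fun k => (h \- (h \o ginv)) \o iter k g : M -> c0 gamma K) ->
     ~ exists gy, one_parameter_subgroup U phi s n gy /\ gy 1 = g).
Proof.
split=> [O openO Oid|iota _ g ginv _ gK gK' _ h indep [gy [gyP gy1]]]; last first.
  apply: (second_difference_dependent charK gK gK' _ indep) => q.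
  by rewrite -gy1; exact: (one_parameter_iter charK gyP).
have [m generic] := exists_generic_point U.
have [j0 _ Um0] : (\bigcup_i U i) m by rewrite (atlas_cover atlasM).
have [rho [r [rho0 rhoP r0 rP]]] := exists_coordinate_ball atlasM Um0.
have [d d0 near_id] := dilate_near_id atlasM generic Um0 rho0 rhoP r0 rP banachX
  le_nn' openO Oid.
have [|y y0] := @small_scalar _ K (Num.min d 1); first by rewrite lt_min d0/=.
rewrite lt_min => /andP[yd y1].
have [g0 _] := gamma_neq0; have [e e0] := c0_neq0 K g0.
have [q nfix] := iter_dilate_neq atlasM r0 rP charK e0 y1 y0.
exists (dilate U phi m j0 r y); split; first exact: near_id.
  by move=> gid; apply: nfix; rewrite gid; elim: (p) => //= k ->.
move=> [gy [gyP _ gy1]]; apply: nfix; rewrite -gy1.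
exact: (one_parameter_iter charK gyP).
Qed.
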